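(* Let $0<\beta<1$ and $\alpha,p,\lambda>0$. The one-dimensional distributions of the fractional negative binomial process $\{Q_\beta(t,\lambda)\}_{t\ge0}$ are not infinitely divisible.
   Context: Gamma process: $\{\Gamma(t)\}_{t\ge0}$ is the gamma subordinator with $\Gamma(t)\sim G(\alpha,pt)$, i.e. with density $\frac{\alpha^{pt}}{\Gamma(pt)}y^{pt-1}e^{-\alpha y}$, $y>0$. Fractional Poisson process (FPP): $\{N_\beta(t,\lambda)\}_{t\ge0}$ satisfies $N_\beta(t,\lambda)\stackrel{d}{=}N(E_\beta(t),\lambda)$, where $\{N(t,\lambda)\}_{t\ge0}$ is a Poisson process of rate $\lambda$, independent of the inverse $\beta$-stable subordinator $E_\beta(t)=\inf\{s>0:D_\beta(s)>t\}$, with $D_\beta$ the $\beta$-stable subordinator, $\mathbb{E}[e^{-sD_\beta(t)}]=e^{-ts^\beta}$. Fractional negative binomial process (FNBP): $Q_\beta(t,\lambda)=N_\beta(\Gamma(t),\lambda)$, $t\ge0$, with $\{N_\beta(t,\lambda)\}_{t\ge0}$ independent of $\{\Gamma(t)\}_{t\ge0}$.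
   Formalization: Proved for all sufficiently large t: there is t0 such that the law of Q_β(t,λ) is not infinitely divisible for every t ≥ t0. For every t > 0 the claim is false: when pt = 1, Γ(t) is exponential and Q_β(t,λ) is geometric, hence infinitely divisible. *)

(* Defs.v *)
From HB Require Import structures.
From mathcomp Require Import all_boot all_order all_algebra.
From mathcomp Require Import all_classical all_reals all_analysis.

Set Implicit Arguments.
Unset Strict Implicit.
Unset Printing Implicit Defensive.

Import Order.TTheory GRing.Theory Num.Theory.
Import numFieldNormedType.Exports.

Local Open Scope classical_set_scope.
Local Open Scope ring_scope.

(* A real process is a family of random variables indexed by R, of which only
   the times t >= 0 are ever constrained. Path properties (initial value,
   monotonicity, right-continuity) are required for every outcome, so that
   composed processes such as N (E t w) w are measurable. *)

Section independence.
Context {R : realType} d {T : measurableType d} (P : probability T R).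

(* Some of the A i may be setT, so this covers every subfamily. *)
Definition mutually_independent n (X : 'I_n -> T -> R) : Prop :=
  forall A : 'I_n -> set R, (forall i, measurable (A i)) ->
  P [set w | forall i, A i (X i w)] = (\prod_(i < n) P (X i @^-1` A i))%E.

(* Independence of the sigma-algebras generated by (X s) s>=0 and (Y t) t>=0,
   stated on the generating pi-systems of finite-dimensional cylinders. *)
Definition independent_processes (X Y : R -> T -> R) : Prop :=
  forall n m (s : 'I_n -> R) (t : 'I_m -> R)
         (A : 'I_n -> set R) (B : 'I_m -> set R),
  (forall i, 0 <= s i) -> (forall j, 0 <= t j) ->
  (forall i, measurable (A i)) -> (forall j, measurable (B j)) ->
  let EX := [set w | forall i, A i (X (s i) w)] in
  let EY := [set w | forall j, B j (Y (t j) w)] in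
  P (EX `&` EY) = (P EX * P EY)%E.

Definition right_continuous_paths (X : R -> T -> R) : Prop :=
  forall w t, 0 <= t -> X s w @[s --> t^'+] --> X t w.

End independence.

Definition same_law {R : realType} d1 d2 (T1 : measurableType d1)
    (T2 : measurableType d2) (P1 : probability T1 R) (P2 : probability T2 R)
    (X : T1 -> R) (Y : T2 -> R) : Prop :=
  forall A : set R, measurable A -> P1 (X @^-1` A) = P2 (Y @^-1` A).

Section subordinators.
Context {R : realType} d {T : measurableType d} (P : probability T R).
Implicit Type X : R -> {RV P >-> R}.

Definition independent_increments X : Prop :=
  forall n (t : nat -> R), 0 <= t 0%N -> nondecreasing_seq t ->
  mutually_independent P (fun (i : 'I_n) w => X (t i.+1) w - X (t i) w).

Definition stationary_increments X : Prop :=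
  forall s t, 0 <= s -> 0 <= t ->
  same_law P P (fun w => X (s + t) w - X s w) (X t).

Definition subordinator X : Prop :=
  [/\ forall w, X 0 w = 0,
      forall w s t, 0 <= s -> s <= t -> X s w <= X t w,
      right_continuous_paths (fun t => X t),
      independent_increments X
    & stationary_increments X].

Definition poisson_process (lambda : R) X : Prop :=
  subordinator X /\
  forall t, 0 < t -> forall k : nat,
    P (X t @^-1` [set k%:R]) = (poisson_pmf (lambda * t) k)%:E.

Definition stable_subordinator (beta : R) X : Prop :=
  subordinator X /\
  forall s t, 0 <= s -> 0 <= t ->
    ('E_P[fun w => expR (- (s * X t w))] = (expR (- (t * s `^ beta)))%:E)%E.

Definition gamma_fun (a : R) : R :=
  \int[lebesgue_measure]_(x in `]0, +oo[) (x `^ (a - 1) * expR (- x)).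

Definition gamma_density (alpha a y : R) : R :=
  alpha `^ a / gamma_fun a * y `^ (a - 1) * expR (- (alpha * y)).

Definition gamma_process (alpha p : R) X : Prop :=
  subordinator X /\
  forall t, 0 < t -> forall A : set R, measurable A ->
    P (X t @^-1` A) =
    (\int[lebesgue_measure]_(y in A `&` `]0%R, +oo[)
       (gamma_density alpha (p * t) y)%:E)%E.

End subordinators.

(* The infimum is over a nonempty set unless the path s |-> D s w is bounded by
   t, a null event for a stable subordinator; there inf set0 = 0. *)
Definition inverse_subordinator {R : realType} (T : Type) (D : R -> T -> R)
    (t : R) (w : T) : R :=
  inf [set s | 0 < s /\ t < D s w].

(* The time-changed Poisson process N (E t) may live on a different probability
   space; only equality of the one-dimensional laws is asked. *)
Definition fractional_poisson_process {R : realType} (beta lambda : R)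
    d (T : measurableType d) (P : probability T R)
    (Nb : R -> {RV P >-> R}) : Prop :=
  right_continuous_paths (fun t => Nb t) /\
  exists (d' : measure_display) (T' : measurableType d')
         (P' : probability T' R) (N D : R -> {RV P' >-> R}),
    let E := inverse_subordinator (fun s => D s) in
    [/\ poisson_process lambda N,
        stable_subordinator beta D,
        independent_processes P' (fun t => N t) E
      & forall t, 0 <= t -> same_law P P' (Nb t) (fun w => N (E t w) w)].

(* Pitfall: for p * t = 1 the variable E (G t) is exponential with rate
   alpha `^ beta, so Q t is geometric, which is infinitely divisible. *)
Definition fractional_negative_binomial_process {R : realType}
    (beta alpha p lambda : R) d (T : measurableType d) (P : probability T R)
    (Q : R -> {RV P >-> R}) : Prop :=
  exists (Nb G : R -> {RV P >-> R}),
    [/\ fractional_poisson_process beta lambda Nb,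
        gamma_process alpha p G,
        independent_processes P (fun t => Nb t) (fun t => G t)
      & forall t, 0 <= t -> forall w, Q t w = Nb (G t w) w].

Definition infinitely_divisible {R : realType}
    (mu : probability R R) : Prop :=
  forall n, (0 < n)%N ->
  exists (d : measure_display) (T : measurableType d) (P : probability T R)
         (X : 'I_n -> {RV P >-> R}),
    [/\ mutually_independent P (fun i => X i),
        forall i j, same_law P P (X i) (X j)
      & forall A : set R, measurable A ->
          mu A = P ((fun w => \sum_(i < n) X i w) @^-1` A)].

(* Main.v *)
Require Import Defs.
From mathcomp Require Import all_boot all_order all_algebra.
From mathcomp Require Import all_classical all_reals all_analysis.
From mathcomp Require Import measurable_realfun.
From mathcomp Require Import ring lra.

(** Write tau = t ^ beta.  For large t the variable Q t / tau behaves like a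
    constant multiple of the inverse stable variable E 1: it keeps a
    nondegenerate spread, while its upper tail is lighter than every
    exponential.  An infinitely divisible law on the half-line cannot have both
    properties.  Indeed, if S is the sum of n independent copies of X >= 0, then
    P(X > x) ^ n <= P(S > n x), so a light tail of S makes every summand
    uniformly small with overwhelming probability, and a sum of many uniformly
    small independent summands is concentrated.

    The contradiction is quantitative and takes place at a fixed time t.  With
    U_i = exp (- h max (X_i, 0)), which lies in [0, 1], independence gives
      Var (prod U_i) = (E U^2) ^ n - (E U) ^ (2 n) <= n Var U <= n E (1 - U)^2
        <= eta n E (1 - U) + n P (U < 1 - eta),
    where n E (1 - U) <= - ln E (prod U_i) stays bounded and U < 1 - eta means
    that X exceeds a threshold x of order eta / h.  If S gives mass at least c to
    both (-oo, A] and [B, +oo) with A < B, the left-hand side is bounded below;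
    choosing eta small and then n large makes the right-hand side smaller.  This
    is [iid_sum_spread], turned into the criterion [not_infinitely_divisible].

    The rest of the file provides the masses and the tail of S = Q t.  The time
    G t lies between p t / (4 alpha) and 4 p t / alpha up to an exponentially
    small probability ([gamma_concentration]); the Poisson process at time s
    lies between lambda s / 4 and 4 lambda s up to an exponentially small
    probability ([poisson_concentration]); and E y > s forces D s <= y, whose
    probability is at most exp (u y - s u ^ beta) for every u >= 0
    ([stable_subordinator_le]).  Taking u = K / t and s of order tau makes the
    last bound exp (K g - s' K ^ beta) with constants g and s' that do not
    depend on t ([fnbp_upper_tail], [fnbp_lower_tail]).  A fixed K gives the
    mass near the origin.  For the tail at n x one takes s' proportional to n
    and K = n: the n-th root of the bound is then exp (g - kappa n ^ beta),
    which is much smaller than 1 / n ([expR_powR_small]).  Only now is t chosen,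
    large enough for the exponentially small errors to be negligible. *)

Set Implicit Arguments.
Unset Strict Implicit.
Unset Printing Implicit Defensive.

Import Order.TTheory GRing.Theory Num.Theory.
Import numFieldNormedType.Exports.

Local Open Scope classical_set_scope.
Local Open Scope ring_scope.

(** * Level sets, right neighbourhoods and elementary inequalities *)

Section level_sets.
Context {R : realType} d (T : measurableType d) (f : T -> R)
  (mf : measurable_fun setT f).

Lemma measurable_lt c : measurable [set w | f w < c].
Proof.
rewrite (_ : [set _ | _] = f @^-1` `]-oo, c[%classic).
  by rewrite -[X in measurable X]setTI; exact: mf.
by apply/seteqP; split => w /=; rewrite in_itv.
Qed.

Lemma measurable_le c : measurable [set w | f w <= c].
Proof.
rewrite (_ : [set _ | _] = f @^-1` `]-oo, c]%classic).
  by rewrite -[X in measurable X]setTI; exact: mf.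
by apply/seteqP; split => w /=; rewrite in_itv.
Qed.

Lemma measurable_gt c : measurable [set w | c < f w].
Proof.
rewrite (_ : [set _ | _] = f @^-1` `]c, +oo[%classic).
  by rewrite -[X in measurable X]setTI; exact: mf.
by apply/seteqP; split => w /=; rewrite in_itv/= andbT.
Qed.

Lemma measurable_ge c : measurable [set w | c <= f w].
Proof.
rewrite (_ : [set _ | _] = f @^-1` `[c, +oo[%classic).
  by rewrite -[X in measurable X]setTI; exact: mf.
by apply/seteqP; split => w /=; rewrite in_itv/= andbT.
Qed.

Lemma measurable_outside a b : measurable [set w | ~~ (a <= f w < b)].
Proof.
rewrite (_ : [set _ | _] = [set w | f w < a] `|` [set w | b <= f w]).
  by apply: measurableU; [exact: measurable_lt|exact: measurable_ge].
apply/seteqP; split => w /=; rewrite negb_and -ltNge -leNgt => /orP//.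
Qed.

End level_sets.

Lemma at_right_itv {R : realType} (x : R) (Q : set R) :
  (\forall y \near x^'+, Q y) -> exists2 e, 0 < e & forall y, x < y < x + e -> Q y.
Proof.
move=> /nbhs_ballP[e /= e0 He]; exists e => // y /andP[xy ye].
apply: He => //=; rewrite /ball/= distrC ger0_norm; lra.
Qed.

Section real_estimates.
Context {R : realType}.

Lemma expR1_bounds :
  [/\ 2 <= expR 1 :> R, expR 1 <= 4 :> R & expR (- 1) <= 2^-1 :> R].
Proof.
have e2 : 2 <= expR 1 :> R by have := expR_ge1Dx (1 : R); lra.
have h : 2^-1 <= expR (- 2^-1) :> R by have := expR_ge1Dx (- 2^-1 : R); lra.
split => //; last by rewrite expRN lef_pV2 ?posrE ?expR_gt0.
have -> : expR 1 = (expR (- 2^-1)) ^- 2 :> R.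
  by rewrite -expRM_natl -expRN; congr expR; field.
rewrite invf_ple ?posrE ?exprn_gt0 ?expR_gt0//.
rewrite (_ : 4^-1 = 2^-1 ^+ 2 :> R); last by field.
by rewrite lerXn2r // nnegrE ?expR_ge0.
Qed.

Lemma expRN_le_inv (x : R) : 0 < x -> expR (- x) <= x^-1.
Proof.
move=> x0; rewrite expRN lef_pV2 ?posrE ?expR_gt0//.
by apply: le_trans (expR_ge1Dx _); rewrite lerDr.
Qed.

Lemma powR_scale (beta x t : R) : 0 <= x -> 0 < t ->
  t `^ beta * (x / t) `^ beta = x `^ beta.
Proof.
move=> x0 t0; rewrite -powRM ?divr_ge0 ?(ltW t0)//.
by rewrite mulrC divfK ?gt_eqF.
Qed.

(** The stretched exponential beats the factor n: with k >= 2 / beta, the k-th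
    term of the exponential series of kappa n ^ beta is at least of order n ^ 2. *)
Lemma expR_powR_small (beta kappa g C : R) : 0 < beta -> 0 < kappa -> 0 < C ->
  exists2 n, (0 < n)%N & expR (g - kappa * n%:R `^ beta) <= C / n%:R.
Proof.
move=> b0 k0 C0.
have b20 : 0 <= 2 / beta by rewrite divr_ge0// ltW.
pose k := Num.bound (2 / beta).
have kb : 2 <= beta * k.+1%:R.
  rewrite mulrC -ler_pdivrMr//; apply: le_trans (ltW (archi_boundP b20)) _.
  by rewrite ler_nat.
pose M := expR g * k.+1`!%:R / kappa ^+ k.+1 / C.
have kk0 : 0 < kappa ^+ k.+1 by exact: exprn_gt0.
have M0 : 0 <= M.
  by apply: divr_ge0 (ltW C0); apply: divr_ge0 (ltW kk0); rewrite mulr_ge0 ?expR_ge0.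
exists (Num.bound M).+1 => //; set n := _.+1.
have n0 : 0 < n%:R :> R by rewrite ltr0n.
have Mn : M <= n%:R by apply: le_trans (ltW (archi_boundP M0)) _; rewrite ler_nat.
have nb0 : 0 <= n%:R `^ beta by exact: powR_ge0.
have := expR_ge1Dxn k (mulr_ge0 (ltW k0) nb0).
have n2 : n%:R ^+ 2 <= (n%:R `^ beta) ^+ k.+1.
  rewrite -(powR_mulrn k.+1 nb0) -powRrM -(powR_mulrn 2 (ltW n0)).
  by apply: ler_powR => //; rewrite ler1n.
set E := expR (kappa * _) => hE.
have f0 : 0 < k.+1`!%:R :> R by rewrite ltr0n fact_gt0.
have hE2 : kappa ^+ k.+1 * n%:R ^+ 2 / k.+1`!%:R <= E.
  apply: le_trans hE; apply: ler_wpDl => //.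
  by rewrite ler_pM2r ?invr_gt0// exprMn ler_pM2l.
have E0 : 0 < E by exact: expR_gt0.
rewrite expRB -/E ler_pdivrMr// mulrAC ler_pdivlMr//.
apply: (@le_trans _ _ (C * (kappa ^+ k.+1 * n%:R ^+ 2 / k.+1`!%:R))); last by rewrite ler_pM2l.
rewrite mulrA ler_pdivlMr// expr2.
move: Mn; rewrite /M ler_pdivrMr// ler_pdivrMr// => Mn.
rewrite [leLHS](_ : _ = n%:R * (expR g * k.+1`!%:R)); last by ring.
rewrite [leRHS](_ : _ = n%:R * (n%:R * C * kappa ^+ k.+1)); last by ring.
by rewrite ler_pM2l.
Qed.

(** Errors of the Poisson and gamma concentration bounds, made negligible at
    the end by the choice of t. *)
Lemma eventually_small (beta a b eta : R) : 0 < beta -> 0 < a -> 0 < b -> 0 < eta ->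
  exists2 t0, 0 < t0 & forall t, t0 <= t ->
    2 * expR (- (a * t `^ beta)) + 2 * expR (- (b * t)) <= eta.
Proof.
move=> be0 a0 b0 e0.
pose u := 4 / (a * eta); pose v := 4 / (b * eta).
have u0 : 0 < u by rewrite divr_gt0// mulr_gt0.
have v0 : 0 < v by rewrite divr_gt0// mulr_gt0.
exists (Num.max (u `^ beta^-1) v); first by rewrite lt_max v0 orbT.
move=> t; rewrite ge_max => /andP[tu tv].
have t0 : 0 < t by exact: lt_le_trans tv.
have tb0 : 0 < t `^ beta by exact: powR_gt0.
have tbu : u <= t `^ beta.
  rewrite -[u](_ : (u `^ beta^-1) `^ beta = u); last first.
    by rewrite -powRrM mulVf ?gt_eqF// powRr1// ltW.
  by apply: (ge0_ler_powR (ltW be0)) => //; rewrite nnegrE ?powR_ge0 ?(ltW t0).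
have inv z y : 0 < z -> 4 / (z * eta) <= y -> 2 * expR (- (z * y)) <= eta / 2.
  move=> z0 zy; have y0 : 0 < y by apply: lt_le_trans zy; rewrite divr_gt0// mulr_gt0.
  rewrite -ler_pdivlMl//; apply: le_trans (expRN_le_inv _) _; first exact: mulr_gt0.
  rewrite invf_ple ?posrE ?mulr_gt0 ?invr_gt0 ?divr_gt0//.
  apply: le_trans (_ : z * (4 / (z * eta)) <= _); last by rewrite ler_pM2l.
  by rewrite le_eqVlt; apply/orP; left; apply/eqP; field; rewrite !gt_eqF.
by have := inv a _ a0 tbu; have := inv b _ b0 tv; lra.
Qed.

End real_estimates.

(** * Expectations of products of independent variables *)

Section integrals.
Context {R : realType} d (T : measurableType d) (P : probability T R).

Lemma integrable_unit_itv (f : T -> R) : measurable_fun setT f ->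
  (forall w, 0 <= f w <= 1) -> P.-integrable setT (EFin \o f).
Proof.
move=> mf f01; apply: measurable_bounded_integrable => //.
  exact: le_lt_trans (probability_le1 P measurableT) (ltry _).
exists 1; split; first exact: num_real.
move=> x x1 w _ /=; have /andP[f0 f1] := f01 w.
by rewrite ger0_norm// (le_trans f1)// ltW.
Qed.

Lemma integrable_indic1 (A : set T) :
  measurable A -> P.-integrable setT (EFin \o \1_A).
Proof.
move=> mA; apply: integrable_unit_itv; first exact: measurable_indic.
by move=> w; rewrite indicE ler0n lern1 leq_b1.
Qed.

Lemma Rintegral_sum (I : Type) (s : seq I) (F : I -> T -> R) :
  (forall i, P.-integrable setT (EFin \o F i)) ->
  \int[P]_w (\sum_(i <- s) F i w) = \sum_(i <- s) \int[P]_w F i w.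
Proof.
move=> iF.
have iS r : P.-integrable setT (EFin \o (fun w => \sum_(i <- r) F i w)).
  elim: r => [|i r IH].
    rewrite (_ : _ \o _ = cst 0%E); first exact: integrable0.
    by apply/funext => w /=; rewrite big_nil.
  pose G w := \sum_(i <- r) F i w.
  rewrite (_ : _ \o _ = ((EFin \o F i) \+ (EFin \o G))%E); first exact: integrableD.
  by apply/funext => w /=; rewrite big_cons EFinD.
elim: s => [|i s IH].
  rewrite big_nil (@eq_Rintegral _ _ _ P setT (cst 0)); last by move=> w _; rewrite big_nil.
  by rewrite Rintegral_cst// mul0r.
rewrite big_cons -IH -RintegralD//.
by apply: eq_Rintegral => w _; rewrite big_cons.
Qed.

Lemma Rintegral_indic (A : set T) : measurable A -> \int[P]_w \1_A w = fine (P A).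
Proof. by move=> mA; rewrite /Rintegral integral_indic// setIT. Qed.

Lemma Rintegral_cst_prob (c : R) : \int[P]_w c = c.
Proof.
rewrite -[LHS]/(\int[P]_w (cst c w)) Rintegral_cst// -[RHS]mulr1; congr (_ * _).
exact: (congr1 fine (probability_setT P)).
Qed.

End integrals.

Section layers.
Context {R : realType}.

(** For z in [0, 1] this is z rounded down to a multiple of 1 / m, written as an
    average of indicators so that its products expand into events. *)
Definition layer (m : nat) (z : R) : R :=
  \sum_(j < m) m%:R^-1 * ((j.+1%:R <= m%:R * z)%R%:R).

Lemma measurable_layer (m : nat) (f : R -> R) :
  measurable_fun setT f -> measurable_fun setT (fun y => layer m (f y)).
Proof.
move=> mf; rewrite /layer; apply: measurable_sum => j.
apply: measurable_funM => //; pose h y := m%:R * f y.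
rewrite (_ : (fun y => _) = \1_[set y | j.+1%:R <= h y]).
  have mh : measurable_fun setT h by exact: measurable_funM.
  by apply: measurable_indic; exact: (measurable_ge mh).
apply/funext => x; rewrite indicE; congr (nat_of_bool _)%:R.
by apply/idP/idP => [h1|/set_mem//]; exact/mem_set.
Qed.

Lemma count_below (m : nat) (z : R) : 0 <= z <= m%:R ->
  z - 1 <= \sum_(j < m) ((j.+1%:R <= z)%R%:R : R) <= z.
Proof.
elim: m z => [|m IH] z /andP[z0 zm].
  by rewrite big_ord0; move: zm; rewrite mulr0n => zm; rewrite z0 andbT; lra.
rewrite big_ord_recr/=; have [mz|zlem] := leP m%:R z; last first.
  rewrite [m.+1%:R <= z]leNgt (lt_trans zlem) ?ltr_nat// addr0.
  by apply: IH; rewrite z0 ltW.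
rewrite (eq_bigr (fun=> 1)); last first.
  by move=> j _; rewrite (le_trans _ mz)// ler_nat.
rewrite sumr_const card_ord; move: mz zm; rewrite -natr1.
by move=> mz; case: (leP (m%:R + 1) z) => ? /=; lra.
Qed.

Lemma layer_approx (m : nat) (z : R) : (0 < m)%N -> 0 <= z <= 1 ->
  z - m%:R^-1 <= layer m z <= z.
Proof.
move=> m0 /andP[z0 z1]; have m0' : 0 < m%:R :> R by rewrite ltr0n.
rewrite /layer -mulr_sumr -(ler_pM2l m0') -[X in _ && X](ler_pM2l m0').
rewrite mulrBr mulVKf ?gt_eqF// divff ?gt_eqF//.
by apply: count_below; rewrite mulr_ge0 ?ler0n//= -[leRHS]mulr1 ler_pM2l.
Qed.

Lemma prod_near n (x y : 'I_n -> R) (e : R) :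
  (forall i, 0 <= x i <= 1) -> (forall i, 0 <= y i <= 1) ->
  (forall i, y i - e <= x i <= y i) ->
  \prod_i y i - n%:R * e <= \prod_i x i <= \prod_i y i.
Proof.
elim: n x y => [|n IH] x y x01 y01 xy; first by rewrite !big_ord0 mul0r subr0 lexx.
rewrite !big_ord_recl.
have /andP[I1 I2] := IH (x \o lift ord0) (y \o lift ord0)
  (fun i => x01 _) (fun i => y01 _) (fun i => xy _).
rewrite /= in I1 I2.
have /andP[x0 x1] := x01 ord0; have /andP[y0 y1] := y01 ord0.
have /andP[e1 e2] := xy ord0.
have px0 : 0 <= \prod_(i < n) x (lift ord0 i).
  by apply: prodr_ge0 => i _; case/andP: (x01 (lift ord0 i)).
have py1 : \prod_(i < n) y (lift ord0 i) <= 1.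
  by apply: prodr_ile1 => i _; exact: y01.
rewrite -natr1 mulrDl mul1r; move: px0 py1 I1 I2.
move: (\prod_(i < n) x _) (\prod_(i < n) y _) => a b a0 b1 I1 I2.
apply/andP; split; last by rewrite ler_pM.
have e0 : 0 <= e by lra.
have ne0 : 0 <= n%:R * e by rewrite mulr_ge0.
nra.
Qed.

End layers.

Section product.
Context {R : realType} d (T : measurableType d) (P : probability T R).
Context (n : nat) (X : 'I_n -> {RV P >-> R}).
Context (indepX : mutually_independent P (fun i => X i)).

(** Distributing the product over the sums leaves indicators of the events
    whose probabilities the independence hypothesis factorizes. *)
Lemma expectation_prod_layer (m : nat) (f : R -> R) :
  measurable_fun setT f ->
  \int[P]_w (\prod_i layer m (f (X i w))) =
  \prod_i \int[P]_w layer m (f (X i w)).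
Proof.
move=> mf.
pose B (j : 'I_m) : set R := [set y | j.+1%:R <= m%:R * f y].
have mB j : measurable (B j).
  have mmf : measurable_fun setT (fun y => m%:R * f y) by exact: measurable_funM.
  exact: (measurable_ge mmf).
have mXB i j : measurable (X i @^-1` B j) by exact: measurable_funPTI.
have layerE i w : layer m (f (X i w)) = \sum_(j < m) m%:R^-1 * \1_(X i @^-1` B j) w.
  apply: eq_bigr => j _; congr (_ * _); rewrite indicE; congr (nat_of_bool _)%:R.
  by apply/idP/idP => [h|/set_mem//]; apply/mem_set.
have int1 (A : set T) c : measurable A -> P.-integrable setT (EFin \o (fun w => c * \1_A w)).
  move=> mA; rewrite (_ : _ \o _ = fun w => c%:E * (EFin \o \1_A) w)%E.
    by apply: integrableZl => //; exact: integrable_indic1.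
  by apply/funext => w /=; rewrite EFinM.
pose A (g : {ffun 'I_n -> 'I_m}) := [set w | forall i, B (g i) (X i w)].
have mA g : measurable (A g).
  rewrite (_ : A g = \bigcap_(i in setT) (X i @^-1` B (g i))); last first.
    by apply/seteqP; split => [w Aw i _|w Aw i]; [exact: Aw|exact: (Aw i I)].
  by apply: fin_bigcap_measurable => //; exact: finite_finset.
have prodE (g : {ffun 'I_n -> 'I_m}) w :
    \prod_i (m%:R^-1 * \1_(X i @^-1` B (g i)) w) =
    (m%:R^-1) ^+ n * \1_(A g) w :> R.
  rewrite big_split /= prodr_const card_ord; congr (_ * _).
  rewrite indicE; have [/set_mem Aw|Aw] := boolP (w \in A g).
    by rewrite big1// => i _; rewrite indicE mem_set//; exact: Aw.
  suff [i Bi] : exists i, ~ B (g i) (X i w).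
    by rewrite (bigD1 i)//= indicE memNset// mul0r.
  by apply/existsNP; apply: contraNnot Aw => H; exact/mem_set.
transitivity (\int[P]_w \sum_(g : {ffun 'I_n -> 'I_m}) (m%:R^-1) ^+ n * \1_(A g) w).
  apply: eq_Rintegral => w _; under eq_bigr do rewrite layerE.
  by rewrite bigA_distr_bigA/=; apply: eq_bigr => g _; exact: prodE.
rewrite Rintegral_sum; last by move=> g; exact: int1.
transitivity (\prod_(i < n) \sum_(j < m) m%:R^-1 * fine (P (X i @^-1` B j))); last first.
  apply: eq_bigr => i _; transitivity (\int[P]_w \sum_(j < m) m%:R^-1 * \1_(X i @^-1` B j) w).
    rewrite Rintegral_sum; last by move=> j; exact: int1.
    apply: eq_bigr => j _.
    by rewrite RintegralZl ?Rintegral_indic// integrable_indic1.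
  by apply: eq_Rintegral => w _; rewrite layerE.
rewrite bigA_distr_bigA/=; apply: eq_bigr => g _.
rewrite RintegralZl ?Rintegral_indic// ?integrable_indic1//.
rewrite big_split /= prodr_const card_ord; congr (_ * _).
rewrite /A (indepX (fun i => mB (g i))).
rewrite -[RHS]/(fine (_%:E)) -prodEFin; congr fine; apply: eq_bigr => i _.
by rewrite fineK// fin_num_measure.
Qed.

(** Both sides are within n / m of their values for the rounded function
    [layer m], for which they agree; m is arbitrary. *)
Lemma expectation_prod (f : R -> R) :
  measurable_fun setT f -> (forall y, 0 <= f y <= 1) ->
  \int[P]_w (\prod_i f (X i w)) = \prod_i \int[P]_w f (X i w).
Proof.
move=> mf f01.
have mfX i : measurable_fun setT (fun w => f (X i w)) by exact: measurableT_comp.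
have unit_prod (g : 'I_n -> R) : (forall i, 0 <= g i <= 1) -> 0 <= \prod_i g i <= 1.
  move=> g01; rewrite prodr_ile1 ?andbT => [|i _]; last exact: g01.
  by apply: prodr_ge0 => i _; have /andP[] := g01 i.
have iU (g : T -> R) : measurable_fun setT g -> (forall w, 0 <= g w <= 1) ->
    P.-integrable setT (EFin \o g).
  exact: integrable_unit_itv.
have exp01 (g : T -> R) : measurable_fun setT g -> (forall w, 0 <= g w <= 1) ->
    0 <= \int[P]_w g w <= 1.
  move=> mg g01; rewrite Rintegral_ge0/=; last by move=> w _; case/andP: (g01 w).
  rewrite -[leRHS](Rintegral_cst_prob P).
  apply: le_Rintegral => //; first exact: iU.
    by apply: iU => // w; rewrite ler01 lexx.
  by move=> w _; case/andP: (g01 w).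
have layer01 m y : 0 <= layer m (f y) <= 1.
  have [->|m0] := posnP m; first by rewrite /layer big_ord0 lexx ler01.
  have /andP[_ l1] := layer_approx m0 (f01 y).
  have /andP[_ f1] := f01 y.
  rewrite (le_trans l1 f1) andbT; apply: sumr_ge0 => j _.
  by rewrite mulr_ge0// invr_ge0.
have mlayer m i : measurable_fun setT (fun w => layer m (f (X i w))).
  exact: (measurableT_comp (measurable_layer m mf)).
pose a := \int[P]_w (\prod_i f (X i w)); pose b := \prod_i \int[P]_w f (X i w).
suff near m : (0 < m)%N -> `|a - b| <= 2 * n%:R / m%:R.
  apply/eqP; rewrite -subr_eq0 -normr_le0 leNgt; apply/negP => ab0.
  have q0 : 0 <= 2 * n%:R / `|a - b| by rewrite divr_ge0 ?mulr_ge0 ?ler0n ?normr_ge0.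
  have := archi_boundP q0; set m := Num.bound _ => qm.
  have m0 : (0 < m)%N by rewrite -(ltr0n R) (le_lt_trans q0).
  have := near _ m0; rewrite ler_pdivlMr ?ltr0n// leNgt [ltRHS]mulrC -ltr_pdivrMr//.
  by rewrite qm.
move=> m0; have m0' : 0 < m%:R :> R by rewrite ltr0n.
have lA w := prod_near (fun i => layer01 m (X i w)) (fun i => f01 (X i w))
  (fun i => layer_approx m0 (f01 (X i w))).
have mP (g : 'I_n -> T -> R) : (forall i, measurable_fun setT (g i)) ->
    measurable_fun setT (fun w => \prod_i g i w).
  by move=> mg; apply: measurable_prod => i _.
have iPl := iU _ (mP _ (mlayer m)) (fun w => unit_prod _ (fun i => layer01 m (X i w))).
have iPf := iU _ (mP _ mfX) (fun w => unit_prod _ (fun i => f01 (X i w))).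
have icst c : P.-integrable setT (EFin \o cst c).
  exact: finite_measure_integrable_cst.
have a1 : a - n%:R * m%:R^-1 <= \int[P]_w \prod_i layer m (f (X i w)) <= a.
  apply/andP; split; last first.
    by apply: le_Rintegral => // w _; case/andP: (lA w).
  rewrite -[n%:R * _](Rintegral_cst_prob P).
  rewrite -(RintegralB measurableT iPf (icst _)); apply: le_Rintegral => //.
    exact: (integrableB measurableT iPf (icst _)).
  by move=> w _; case/andP: (lA w).
have b1 i : \int[P]_w f (X i w) - m%:R^-1 <= \int[P]_w layer m (f (X i w)) <=
    \int[P]_w f (X i w).
  have ifi := iU _ (mfX i) (fun w => f01 (X i w)).
  have ili := iU _ (mlayer m i) (fun w => layer01 m (X i w)).
  have lf w := layer_approx m0 (f01 (X i w)).
  apply/andP; split; last first.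
    by apply: le_Rintegral => // w _; case/andP: (lf w).
  rewrite -[m%:R^-1](Rintegral_cst_prob P).
  rewrite -(RintegralB measurableT ifi (icst _)); apply: le_Rintegral => //.
    exact: (integrableB measurableT ifi (icst _)).
  by move=> w _; case/andP: (lf w).
have := prod_near (fun i => exp01 _ (mlayer m i) (fun w => layer01 m (X i w)))
  (fun i => exp01 _ (mfX i) (fun w => f01 (X i w))) b1.
rewrite -(expectation_prod_layer m mf) -/b => b2.
have : 0 <= n%:R * m%:R^-1 :> R by rewrite mulr_ge0// invr_ge0.
move: a1 b2; rewrite ler_norml -mulrA; move: (n%:R * _) (\int[P]_w _) => e I.
by lra.
Qed.

End product.

(** * A criterion against infinite divisibility *)

Section variance_bound.
Context {R : realType}.

(** Telescoping of a ^ n - b ^ n; with a = E U^2 and b = (E U)^2 it says that the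
    variance of a product of n independent copies of U is at most n Var U. *)
Lemma lerB_expn (a b : R) n : 0 <= b -> b <= a -> a <= 1 ->
  a ^+ n - b ^+ n <= n%:R * (a - b).
Proof.
move=> b0 ba a1; have a0 := le_trans b0 ba.
elim: n => [|n IH]; first by rewrite !expr0 subrr mul0r.
have an : 0 <= a ^+ n <= 1 by rewrite exprn_ge0// exprn_ile1.
have bn : 0 <= b ^+ n <= 1 by rewrite exprn_ge0// exprn_ile1// (le_trans ba).
rewrite !exprS -natr1 mulrDl mul1r; move: an bn IH.
have : 0 <= n%:R * (a - b) by rewrite mulr_ge0// subr_ge0.
move: (a ^+ n) (b ^+ n) (n%:R * _) => x y z z0 /andP[x0 x1] /andP[y0 y1] xyz.
have h1 : a * (x - y) <= a * z by rewrite ler_wpM2l.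
have h2 : a * z <= z by rewrite ler_piMl.
have h3 : (a - b) * y <= a - b by rewrite ler_piMr// subr_ge0.
lra.
Qed.

Context d (T : measurableType d) (P : probability T R).
Implicit Types V : T -> R.

Local Notation E f := (\int[P]_w f w).

(** Whatever the centre M, one of the two events lies entirely on the other
    side of the midpoint of v1 and v2. *)
Lemma unit_itv_spread V (M v1 v2 c : R) :
  measurable_fun setT V -> (forall w, 0 <= V w <= 1) ->
  0 <= c -> v2 < v1 ->
  (c%:E <= P [set w | (v1 <= V w)%R])%E -> (c%:E <= P [set w | (V w <= v2)%R])%E ->
  c * ((v1 - v2) / 2) ^+ 2 <= \int[P]_w (V w - M) ^+ 2.
Proof.
move=> mV V01 c0 v21 P1 P2.
pose S := if M <= (v1 + v2) / 2 then [set w | v1 <= V w] else [set w | V w <= v2].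
have mS : measurable S.
  by rewrite /S; case: ifP => _; [exact: measurable_ge|exact: measurable_le].
have PS : c <= fine (P S).
  by rewrite -lee_fin fineK ?fin_num_measure// /S; case: ifP.
have iS := integrable_indic1 P mS.
set g := ((v1 - v2) / 2) ^+ 2.
apply: (@le_trans _ _ (\int[P]_w (g * \1_S w))).
  by rewrite RintegralZl// Rintegral_indic// mulrC ler_wpM2l// sqr_ge0.
apply: le_Rintegral => //.
- exact: (integrableZl measurableT g iS).
- apply: measurable_bounded_integrable => //.
  + exact: le_lt_trans (probability_le1 P measurableT) (ltry _).
  + by apply: measurable_funX; exact: measurable_funB.
  exists ((1 + `|M|) ^+ 2); split; first exact: num_real.
  move=> x x1 w _ /=; apply: le_trans (ltW x1); rewrite normrX lerXn2r ?nnegrE ?addr_ge0//.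
  apply: le_trans (ler_normB _ _) _; rewrite lerD2r.
  by have /andP[V0 V1] := V01 w; rewrite ger0_norm.
move=> w _; rewrite indicE; have [/set_mem|_] := boolP (w \in S); last first.
  by rewrite mulr0 sqr_ge0.
rewrite mulr1 /g /S; case: ifPn => /=; last rewrite -ltNge; nra.
Qed.

(** Off the event V < 1 - eta one factor of (1 - V)^2 is at most eta; on it the
    square is at most 1. *)
Lemma expectation_deficit V (eta delta : R) :
  measurable_fun setT V -> (forall w, 0 <= V w <= 1) ->
  0 <= eta -> (P [set w | (V w < 1 - eta)%R] <= delta%:E)%E ->
  \int[P]_w (1 - V w) ^+ 2 <= eta * (1 - E V) + delta.
Proof.
move=> mV V01 eta0 Pd; set A := [set w | _] in Pd.
have mA : measurable A by exact: measurable_lt.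
have i1 (g : T -> R) : measurable_fun setT g -> (forall w, 0 <= g w <= 1) ->
    P.-integrable setT (EFin \o g).
  exact: integrable_unit_itv.
have i1V : P.-integrable setT (EFin \o (fun w => 1 - V w)).
  apply: i1; first exact: measurable_funB.
  by move=> w; have /andP[? ?] := V01 w; apply/andP; split; lra.
have i1V2 : P.-integrable setT (EFin \o (fun w => (1 - V w) ^+ 2)).
  apply: i1; first by apply: measurable_funX; exact: measurable_funB.
  by move=> w; have /andP[? ?] := V01 w; apply/andP; split; nra.
have iV : P.-integrable setT (EFin \o V) by exact: i1.
have ic c : P.-integrable setT (EFin \o cst c) by exact: finite_measure_integrable_cst.
have iA := integrable_indic1 P mA.
have ieV : P.-integrable setT (EFin \o (fun w => eta * (1 - V w))).
  exact: (integrableZl measurableT eta i1V).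
have -> : 1 - E V = \int[P]_w (1 - V w).
  by rewrite (RintegralB measurableT (ic 1) iV) Rintegral_cst_prob.
rewrite -RintegralZl//.
apply: (@le_trans _ _ (\int[P]_w (eta * (1 - V w) + \1_A w))); last first.
  rewrite RintegralD// lerD2l Rintegral_indic//.
  by rewrite -lee_fin fineK ?fin_num_measure.
apply: le_Rintegral => //; first exact: (integrableD measurableT ieV iA).
move=> w _; have /andP[V0 V1] := V01 w.
rewrite indicE; have [/set_mem/= Aw|/negP Aw] := boolP (w \in A).
  by rewrite /=; nra.
have : 1 - eta <= V w by rewrite leNgt; apply/negP => h; apply: Aw; exact/mem_set.
by rewrite /= addr0; nra.
Qed.

Lemma expectation_ge_prob V (v c : R) :
  measurable_fun setT V -> (forall w, 0 <= V w <= 1) -> 0 <= v ->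
  (c%:E <= P [set w | (v <= V w)%R])%E -> c * v <= E V.
Proof.
move=> mV V01 v0 Pc; set A := [set w | _] in Pc.
have mA : measurable A by exact: measurable_ge.
have iA := integrable_indic1 P mA.
apply: (@le_trans _ _ (\int[P]_w (v * \1_A w))).
  rewrite RintegralZl// Rintegral_indic// mulrC ler_wpM2l//.
  by rewrite -lee_fin fineK ?fin_num_measure.
apply: le_Rintegral => //; first exact: (integrableZl measurableT v iA).
  exact: integrable_unit_itv.
move=> w _; rewrite indicE; have [/set_mem/= Aw|_] := boolP (w \in A); first by rewrite mulr1.
by rewrite mulr0; case/andP: (V01 w).
Qed.

(** The core inequality.  The variance of the product is bounded below by
    [unit_itv_spread] and above by n E (1 - f X)^2, hence by
    [expectation_deficit].  The remaining n E (1 - f X) is controlled by the mean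
    of the product itself: (E f X) ^ n <= exp (- n E (1 - f X)), while this mean
    is at least c v1. *)
Lemma iid_prod_spread n (X : 'I_n -> {RV P >-> R}) (f : R -> R) (i0 : 'I_n)
    (v1 v2 c eta delta : R) :
  mutually_independent P (fun i => X i) ->
  (forall i j, same_law P P (X i) (X j)) ->
  measurable_fun setT f -> (forall y, 0 <= f y <= 1) ->
  0 < c -> 0 < v1 -> v2 < v1 -> 0 <= eta ->
  (c%:E <= P [set w | (v1 <= \prod_i f (X i w))%R])%E ->
  (c%:E <= P [set w | (\prod_i f (X i w) <= v2)%R])%E ->
  (P [set w | (f (X i0 w) < 1 - eta)%R] <= delta%:E)%E ->
  c * ((v1 - v2) / 2) ^+ 2 <= eta * (- ln (c * v1)) + n%:R * delta.
Proof.
move=> indX idX mf f01 c0 v10 v21 eta0 P1 P2 Pd.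
pose V w := \prod_i f (X i w).
have V01 w : 0 <= V w <= 1.
  apply/andP; split; last by apply: prodr_ile1 => i _; exact: f01.
  by apply: prodr_ge0 => i _; case/andP: (f01 (X i w)).
have mfX i : measurable_fun setT (fun w => f (X i w)) by exact: measurableT_comp.
have mV : measurable_fun setT V by apply: measurable_prod => i _.
have i1 (g : T -> R) : measurable_fun setT g -> (forall w, 0 <= g w <= 1) ->
    P.-integrable setT (EFin \o g).
  exact: integrable_unit_itv.
have law (g : R -> R) i : measurable_fun setT g -> (forall y, 0 <= g y <= 1) ->
    \int[P]_w g (X i w) = \int[P]_w g (X i0 w).
  move=> mg g01; rewrite /Rintegral; congr fine.
  have mgE : measurable_fun setT (EFin \o g) by exact/measurable_EFinP.
  have H j : (\int[P]_w (g (X j w))%:E = \int[distribution P (X j)]_y (g y)%:E)%E.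
    rewrite ge0_integral_distribution// => y; rewrite lee_fin.
    by case/andP: (g01 y).
  rewrite !H; apply: eq_measure_integral => A mA _; exact: idX.
pose m1 := \int[P]_w f (X i0 w); pose m2 := \int[P]_w (f (X i0 w)) ^+ 2.
have f2_01 y : 0 <= f y ^+ 2 <= 1.
  by have /andP[? ?] := f01 y; apply/andP; split; nra.
have mf2 : measurable_fun setT (fun y => f y ^+ 2) by exact: measurable_funX.
have EV : E V = m1 ^+ n.
  rewrite expectation_prod// (eq_bigr (fun=> m1)) ?prodr_const ?card_ord// => i _.
  exact: law.
have EV2 : \int[P]_w (V w ^+ 2) = m2 ^+ n.
  transitivity (\int[P]_w \prod_i (f (X i w)) ^+ 2).
    by apply: eq_Rintegral => w _; rewrite -prodrXl.
  rewrite (expectation_prod indX mf2)// (eq_bigr (fun=> m2)) ?prodr_const ?card_ord// => i _.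
  exact: (law (fun y => f y ^+ 2)).
have ic r : P.-integrable setT (EFin \o cst r) by exact: finite_measure_integrable_cst.
have moments (W : T -> R) r : measurable_fun setT W -> (forall w, 0 <= W w <= 1) ->
    \int[P]_w (W w - r) ^+ 2 = \int[P]_w (W w ^+ 2) - 2 * r * E W + r ^+ 2.
  move=> mW W01.
  have iW := i1 _ mW W01.
  have iW2 : P.-integrable setT (EFin \o (fun w => W w ^+ 2)).
    apply: i1; first exact: measurable_funX.
    by move=> w; have /andP[? ?] := W01 w; apply/andP; split; nra.
  have irW : P.-integrable setT (EFin \o (fun w => 2 * r * W w)).
    exact: (integrableZl measurableT (2 * r) iW).
  rewrite -(Rintegral_cst_prob P (r ^+ 2)) -RintegralZl// -RintegralB//.
  rewrite -RintegralD//; [|exact: (integrableB measurableT iW2 irW)|exact: (ic (r ^+ 2))].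
  by apply: eq_Rintegral => w _; ring.
have var0 : m1 ^+ 2 <= m2.
  have : 0 <= \int[P]_w (f (X i0 w) - m1) ^+ 2 by apply: Rintegral_ge0 => w _; exact: sqr_ge0.
  by rewrite (moments (fun w => f (X i0 w)))// -/m1 -/m2; nra.
have m2le1 : m2 <= 1.
  rewrite -(Rintegral_cst_prob P 1); apply: le_Rintegral => //.
  - by apply: i1 => [|w]; [exact: (measurable_funX 2 (mfX i0))|exact: f2_01].
  - exact: (ic 1).
  - by move=> w _; case/andP: (f2_01 (X i0 w)).
have spread := unit_itv_spread (E V) mV V01 (ltW c0) v21 P1 P2.
rewrite (moments V)// EV2 EV in spread.
have tele := lerB_expn n (sqr_ge0 m1) var0 m2le1.
have defi := expectation_deficit (mfX i0) (fun w => f01 (X i0 w)) eta0 Pd.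
have defE : \int[P]_w (1 - f (X i0 w)) ^+ 2 = m2 - 2 * m1 + 1.
  rewrite -[RHS](_ : m2 - 2 * 1 * m1 + 1 ^+ 2 = _); last by ring.
  rewrite -(moments (fun w => f (X i0 w)))//; apply: eq_Rintegral => w _; ring.
rewrite defE -/m1 in defi.
have lnb : n%:R * (1 - m1) <= - ln (c * v1).
  have h1 : c * v1 <= m1 ^+ n by rewrite -EV; exact: expectation_ge_prob (ltW v10) P1.
  have h2 : m1 ^+ n <= expR (- (n%:R * (1 - m1))).
    rewrite -mulrN expRM_natl lerXn2r ?nnegrE ?expR_ge0//.
      by apply: Rintegral_ge0 => w _; case/andP: (f01 (X i0 w)).
    by apply: le_trans (expR_ge1Dx _); lra.
  rewrite lerNr -ler_expR lnK ?posrE ?mulr_gt0//.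
  exact: le_trans h1 h2.
have n0 : 0 <= n%:R :> R by [].
have s1 : n%:R * (m2 - m1 ^+ 2) <= n%:R * (eta * (1 - m1) + delta).
  rewrite ler_wpM2l//; move: defi (sqr_ge0 (1 - m1)); nra.
rewrite -exprM mulnC exprM in tele.
have s2 : eta * (n%:R * (1 - m1)) <= eta * (- ln (c * v1)) by rewrite ler_wpM2l.
move: spread tele s1 s2; move: (m1 ^+ n) (m2 ^+ n) (ln _) n%:R => a b l N.
nra.
Qed.

End variance_bound.

Section iid_sum.
Context {R : realType} d (T : measurableType d) (P : probability T R).
Context (n : nat) (X : 'I_n -> {RV P >-> R}) (i0 : 'I_n).
Context (indepX : mutually_independent P (fun i => X i)).
Context (idX : forall i j, same_law P P (X i) (X j)).
Local Notation S w := (\sum_(i < n) X i w).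

Let mS : measurable_fun setT (fun w => S w).
Proof. exact: measurable_sum. Qed.

Let ord_gt0 : (0 < n)%N. Proof. by case: n i0 => // -[]. Qed.

Lemma iid_all (C : set R) : measurable C ->
  P [set w | forall i, C (X i w)] = (fine (P (X i0 @^-1` C)) ^+ n)%:E.
Proof.
move=> mC; rewrite (indepX (fun=> mC)).
have mX : measurable (X i0 @^-1` C) by exact: measurable_funPTI.
rewrite (eq_bigr (fun=> (fine (P (X i0 @^-1` C)))%:E)); last first.
  by move=> i _; rewrite fineK ?fin_num_measure//; exact: idX.
by rewrite prodEFin prodr_const card_ord.
Qed.

Lemma measurable_all (C : set R) : measurable C ->
  measurable [set w | forall i, C (X i w)].
Proof.
move=> mC; rewrite (_ : [set _ | _] = \bigcap_(i in setT) (X i @^-1` C)).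
  apply: fin_bigcap_measurable; first exact: finite_finset.
  by move=> i _; exact: measurable_funPTI.
by apply/seteqP; split => [w Aw i _|w Aw i]; [exact: Aw|exact: (Aw i I)].
Qed.

(** If all summands fall in C then F occurs: a bound e ^ n on P F therefore
    bounds the probability of C for a single summand by e. *)
Lemma iid_le (C : set R) (F : set T) (e : R) : measurable C -> measurable F -> 0 <= e ->
  [set w | forall i, C (X i w)] `<=` F -> (P F <= (e ^+ n)%:E)%E ->
  (P (X i0 @^-1` C) <= e%:E)%E.
Proof.
move=> mC mF e0 CF PF.
have mX : measurable (X i0 @^-1` C) by exact: measurable_funPTI.
have : ((fine (P (X i0 @^-1` C)) ^+ n)%:E <= (e ^+ n)%:E)%E.
  by rewrite -iid_all//; apply: le_trans PF; rewrite le_measure ?inE//; exact: measurable_all.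
rewrite lee_fin ler_pXn2r ?nnegrE ?fine_ge0// => h.
by rewrite -[X in (X <= _)%E]fineK ?fin_num_measure// lee_fin.
Qed.

Lemma iid_tail (x e : R) : 0 <= e ->
  (P [set w | (n%:R * x < S w)%R] <= (e ^+ n)%:E)%E ->
  (P [set w | (x < X i0 w)%R] <= e%:E)%E.
Proof.
move=> e0 PS.
have -> : [set w | x < X i0 w] = X i0 @^-1` `]x, +oo[%classic.
  by apply/seteqP; split => w /=; rewrite in_itv/= andbT.
apply: (iid_le (F := [set w | n%:R * x < S w])) => //.
  exact: (measurable_gt mS).
move=> w /= Xw; rewrite mulr_natl -[X in _ *+ X]card_ord -sumr_const.
apply: ltr_sum => [|i _]; last by have := Xw i; rewrite in_itv/= andbT.
by apply/hasP; exists i0; rewrite ?mem_index_enum.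
Qed.

(** A sum of copies of X is negative with probability at least P(X < 0) ^ n. *)
Lemma iid_ge0 : P [set w | S w < 0] = 0%E -> P [set w | forall i, 0 <= X i w] = 1%E.
Proof.
move=> PS.
have neg0 : P (X i0 @^-1` `]-oo, 0[%classic) = 0%E.
  apply/eqP; rewrite eq_le measure_ge0 andbT.
  apply: (iid_le (F := [set w | S w < 0])) => //.
  - exact: (measurable_lt mS).
  - move=> w /= Xw; rewrite -[ltRHS](_ : \sum_(i < n) 0 = 0); last by rewrite big1.
    apply: ltr_sum => [|i _]; last by have := Xw i; rewrite in_itv/=.
    by apply/hasP; exists i0; rewrite ?mem_index_enum.
  - by rewrite PS lee_fin exprn_ge0.
have pos1 : P (X i0 @^-1` `[0, +oo[%classic) = 1%E.
  rewrite -[X in P X]setCK probability_setC; last first.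
    by apply: measurableC; exact: measurable_funPTI.
  rewrite (_ : ~` _ = X i0 @^-1` `]-oo, 0[%classic) ?neg0 ?sube0//.
  by apply/seteqP; split => w /=; rewrite !in_itv/= andbT ltNge => /negP.
rewrite (_ : [set _ | _] = [set w | forall i, `[0, +oo[%classic (X i w)]).
  by rewrite iid_all// pos1 expr1n.
by apply/seteqP; split => w Xw i; have := Xw i; rewrite /= in_itv/= andbT.
Qed.

(** Apply [iid_prod_spread] to f y = exp (- h max (y, 0)), for which the product
    is exp (- h S) whenever no summand is negative.  A sum with mass on both
    sides of the gap ]A, B[ thus needs summands that exceed x with probability
    at least of order 1 / n, unless h x is large. *)
Lemma iid_sum_spread (h x A B c delta : R) :
  P [set w | S w < 0] = 0%E ->
  0 < h -> 0 <= x -> 0 <= A -> A < B -> 0 < c ->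
  (c%:E <= P [set w | (S w <= A)%R])%E -> (c%:E <= P [set w | (B <= S w)%R])%E ->
  (P [set w | (x < X i0 w)%R] <= delta%:E)%E ->
  c * ((expR (- (h * A)) - expR (- (h * B))) / 2) ^+ 2 <=
    h * x * (h * A - ln c) + n%:R * delta.
Proof.
move=> S0 h0 x0 A0 AB c0 PA PB Pd.
pose f y := expR (- (h * Num.max y 0)).
have mf : measurable_fun setT f.
  apply: measurableT_comp => //; apply: measurableT_comp => //.
  by apply: measurable_funM => //; exact: measurable_maxr.
have f01 y : 0 <= f y <= 1.
  rewrite expR_ge0 /= /f expR_le1 oppr_le0 mulr_ge0// ?(ltW h0)//.
  by rewrite le_max lexx orbT.
have prodf w : \prod_i f (X i w) = expR (- (h * \sum_i Num.max (X i w) 0)).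
  by rewrite mulr_sumr -sumrN expR_sum.
have mprod : measurable_fun setT (fun w => \prod_i f (X i w)).
  by apply: measurable_prod => i _; exact: measurableT_comp.
pose F := [set w | forall i, 0 <= X i w].
have PF : P F = 1%E by exact: iid_ge0.
have mF : measurable F.
  rewrite (_ : F = [set w | forall i, `[0, +oo[%classic (X i w)]).
    exact: measurable_all.
  by apply/seteqP; split => w Xw i; have := Xw i; rewrite /= in_itv/= andbT.
have PFC : P (~` F) = 0%E by rewrite probability_setC// PF subee.
have c1 : c <= 1.
  rewrite -lee_fin; apply: le_trans PA _; apply: probability_le1.
  exact: (measurable_le mS).
have ehx : 1 - expR (- (h * x)) <= h * x by have := expR_ge1Dx (- (h * x)); lra.
have eta0 : 0 <= 1 - expR (- (h * x)).
  by rewrite subr_ge0 expR_le1 oppr_le0 mulr_ge0// ltW.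
have := iid_prod_spread (f := f) (i0 := i0) (v1 := expR (- (h * A)))
  (v2 := expR (- (h * B))) (c := c) (eta := 1 - expR (- (h * x)))
  (delta := delta) indepX idX mf f01 c0 (expR_gt0 _).
rewrite ltr_expR ltrN2 ltr_pM2l// => /(_ AB eta0).
have -> : - ln (c * expR (- (h * A))) = h * A - ln c.
  by rewrite lnM ?posrE ?expR_gt0// expRK; ring.
move=> spread; apply: le_trans (spread _ _ _) _.
- apply: le_trans PA _; rewrite -[leRHS]adde0 -PFC.
  apply: le_trans (measureU2 _ (measurable_ge mprod _) (measurableC mF)).
  rewrite le_measure ?inE//; first exact: (measurable_le mS).
    apply: measurableU; first exact: (measurable_ge mprod).
    exact: measurableC.
  move=> w /= SA; have [Fw|nFw] := pselect (F w); [left|by right].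
  rewrite /= prodf ler_expR lerN2 ler_pM2l// (le_trans _ SA)//.
  by apply: ler_sum => i _; rewrite (max_idPl _)//; exact: Fw.
- apply: le_trans PB _; rewrite le_measure ?inE//.
  + exact: (measurable_ge mS).
  + exact: (measurable_le mprod).
  move=> w /= BS.
  rewrite prodf ler_expR lerN2 ler_pM2l// (le_trans BS)//.
  by apply: ler_sum => i _; rewrite le_max lexx.
- apply: le_trans Pd; rewrite le_measure ?inE//.
  + have mfX : measurable_fun setT (fun w => f (X i0 w)) by exact: measurableT_comp.
    exact: (measurable_lt mfX).
  + exact: measurable_gt.
  + move=> w /=; rewrite opprB addrCA subrr addr0 /f ltr_expR ltrN2 ltr_pM2l//.
    by rewrite lt_max [x < 0]ltNge x0 orbF.
- rewrite lerD2r ler_wpM2r// subr_ge0 (@le_trans _ _ 0)//; first exact: ln_le0.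
  by rewrite mulr_ge0// ltW.
Qed.

End iid_sum.

(** Contrapositive of [iid_sum_spread]: the tail of mu at n x bounds the tail of
    a single summand at x by delta, because all n summands may exceed x at
    once. *)
Lemma not_infinitely_divisible (R : realType) (mu : probability R R) (n : nat)
    (h x A B c delta : R) :
  (0 < n)%N -> 0 < h -> 0 <= x -> 0 <= A -> A < B -> 0 < c -> 0 <= delta ->
  mu [set y | y < 0] = 0%E ->
  (c%:E <= mu [set y | (y <= A)%R])%E -> (c%:E <= mu [set y | (B <= y)%R])%E ->
  (mu [set y | (n%:R * x < y)%R] <= (delta ^+ n)%:E)%E ->
  h * x * (h * A - ln c) + n%:R * delta <
    c * ((expR (- (h * A)) - expR (- (h * B))) / 2) ^+ 2 ->
  ~ infinitely_divisible mu.
Proof.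
move=> n0 h0 x0 A0 AB c0 d0 mu0 muA muB mutail lt_spread.
move=> /(_ n n0)[d [T [P [X [indX idX lawX]]]]].
have mid : measurable_fun setT (@id R) by [].
rewrite (lawX _ (measurable_lt mid 0)) in mu0.
rewrite (lawX _ (measurable_le mid A)) in muA.
rewrite (lawX _ (measurable_ge mid B)) in muB.
rewrite (lawX _ (measurable_gt mid _)) in mutail.
have Xtail := iid_tail (Ordinal n0) indX idX d0 mutail.
have := iid_sum_spread indX idX mu0 h0 x0 A0 AB c0 muA muB Xtail.
by rewrite leNgt lt_spread.
Qed.

(** * Concentration of the gamma process *)

Section gamma.
Context {R : realType}.
Local Notation mu := (@lebesgue_measure R).

Lemma preimage_mull_itvoc (c a b : R) : 0 < c ->
  ( *%R c) @^-1` `]a, b] = `]c^-1 * a, c^-1 * b]%classic.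
Proof.
move=> c0; apply/seteqP; split => x /=; rewrite !in_itv /= ler_pdivlMl // ltr_pdivrMl //.
Qed.

(** The right-hand side is c times the Lebesgue measure of the set of x with
    c x in A; uniqueness reduces the equality to half-open intervals. *)
Lemma lebesgue_measure_scale (c : {nonneg R}) (A : set R) : 0 < c%:num -> measurable A ->
  mu A = pushforward (mscale c mu) ( *%R c%:num : _ -> measurableTypeR R) A.
Proof.
move=> c0 mA; apply/lebesgue_measure_unique => //= _ [[a b]] _ <-.
rewrite /pushforward /mscale /= preimage_mull_itvoc// !lebesgue_measure_itv/=.
rewrite !lte_fin ltr_pM2l ?invr_gt0//; case: ifPn => // _; last by rewrite mule0.
by rewrite -EFinB -EFinM; congr EFin; rewrite -mulrBr mulVKf// gt_eqF.
Qed.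

Lemma ge0_integral_scale (c : R) (D : set R) (f : R -> R) : 0 < c -> measurable D ->
  measurable_fun D f -> (forall x, D x -> 0 <= f x) ->
  (\int[mu]_(x in D) (f x)%:E =
   c%:E * \int[mu]_(x in ( *%R c) @^-1` D) (f (c * x))%:E)%E.
Proof.
move=> c0 mD mf f0.
pose k := NngNum (ltW c0).
have mc : measurable_fun setT ( *%R c : measurableTypeR R -> measurableTypeR R).
  exact: mulrl_measurable.
have mf' : measurable_fun D (EFin \o f) by apply/measurable_EFinP.
have -> : (\int[mu]_(x in D) (f x)%:E =
    \int[pushforward (mscale k mu) ( *%R c : _ -> measurableTypeR R)]_(x in D) (f x)%:E)%E.
  by apply: eq_measure_integral => A mA _; exact: (@lebesgue_measure_scale k).
rewrite ge0_integral_pushforward//; last first.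
  by move=> y /set_mem Dy; rewrite lee_fin f0.
rewrite ge0_integral_mscale//=.
- by rewrite -[X in measurable X]setTI; exact: mc.
- apply/measurable_EFinP.
  apply: (measurable_comp mD) => //.
  by move=> _ [x Dx <-].
- by move=> x Dx; rewrite lee_fin f0.
Qed.

Lemma gamma_fun_ge0 (a : R) : 0 <= gamma_fun a.
Proof. by apply: Rintegral_ge0 => x _; rewrite mulr_ge0 ?powR_ge0 ?expR_ge0. Qed.

Lemma gamma_density_ge0 (alpha a y : R) : 0 <= gamma_density alpha a y.
Proof.
by rewrite /gamma_density !mulr_ge0 ?invr_ge0 ?powR_ge0 ?expR_ge0 ?gamma_fun_ge0.
Qed.

Lemma measurable_gamma_density (alpha a : R) D : measurable D ->
  measurable_fun D (gamma_density alpha a).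
Proof.
move=> mD; apply: measurable_funTS; rewrite /gamma_density.
apply: measurable_funM.
  by apply: measurable_funM => //; exact: measurable_powR.
apply: measurableT_comp => //; apply: measurableT_comp => //.
Qed.

(** The moment generating function of the gamma law at alpha (1 - 1 / c): under
    the substitution y = c x the exponential tilt only rescales the density. *)
Lemma integral_gamma_density_tilt (alpha a c : R) : 0 < c ->
  (\int[mu]_(y in `]0%R, +oo[)
     (expR (alpha * (1 - c^-1) * y) * gamma_density alpha a y)%:E =
   (c `^ a)%:E * \int[mu]_(y in `]0%R, +oo[) (gamma_density alpha a y)%:E)%E.
Proof.
move=> c0.
have mexp D : measurable D -> measurable_fun D (fun y : R => expR (alpha * (1 - c^-1) * y)).
  move=> mD; apply: measurable_funTS.
  by apply: measurableT_comp => //; exact: measurable_funM.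
rewrite (@ge0_integral_scale c _
  (fun y => expR (alpha * (1 - c^-1) * y) * gamma_density alpha a y))//; last 2 first.
- by apply: measurable_funM; [exact: mexp|exact: measurable_gamma_density].
- by move=> x _; rewrite mulr_ge0 ?expR_ge0 ?gamma_density_ge0.
have -> : *%R c @^-1` `]0, +oo[%classic = `]0, +oo[%classic.
  by apply/seteqP; split => x /=; rewrite !in_itv/= !andbT pmulr_rgt0.
rewrite -!ge0_integralZl//=; last 6 first.
- by apply/measurable_EFinP; exact: measurable_gamma_density.
- by move=> x _; rewrite lee_fin gamma_density_ge0.
- by rewrite lee_fin powR_ge0.
- apply/measurable_EFinP; apply: measurable_funM.
    apply: measurable_funTS; apply: measurableT_comp => //.
    by apply: measurable_funM => //; exact: measurable_funM.
  apply: measurableT_comp; first exact: measurable_gamma_density.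
  exact: measurable_funM.
- by move=> x _; rewrite lee_fin mulr_ge0 ?expR_ge0 ?gamma_density_ge0.
- by rewrite lee_fin ltW.
apply: eq_integral => x; rewrite inE /= in_itv/= andbT => x0.
rewrite -!EFinM; congr EFin; rewrite /gamma_density.
rewrite powRM ?(ltW c0) ?(ltW x0)//.
rewrite (powRB (x := c)) ?(gt_eqF c0) ?implybT// powRr1 ?(ltW c0)//.
have -> : expR (- (alpha * x)) =
    expR (alpha * (1 - c^-1) * (c * x)) * expR (- (alpha * (c * x))).
  by rewrite -expRD; congr expR; field; rewrite gt_eqF.
by move: (_ / gamma_fun a) => C; field; rewrite gt_eqF.
Qed.

(** Chernoff bound: c > 1 serves for upper tails and c < 1 for lower tails. *)
Lemma gamma_chernoff d (T : measurableType d) (P : probability T R)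
    (alpha p : R) (G : R -> {RV P >-> R}) (t c K : R) (A : set R) :
  gamma_process alpha p G -> 0 < t -> 0 < c -> measurable A ->
  (forall y, A y -> 0 < y -> K <= alpha * (1 - c^-1) * y) ->
  (P (G t @^-1` A) <= (expR (- K) * c `^ (p * t))%:E)%E.
Proof.
move=> [_ lawG] t0 c0 mA AK.
have mA0 : measurable (A `&` `]0, +oo[%classic) by exact: measurableI.
pose e (y : R) := expR (alpha * (1 - c^-1) * y).
have me D : measurable_fun D e.
  apply: measurable_funTS.
  by apply: measurableT_comp => //; exact: measurable_funM.
have mge D : measurable D ->
    measurable_fun D (fun y => e y * gamma_density alpha (p * t) y).
  by move=> mD; apply: measurable_funM => //; exact: measurable_gamma_density.
have ge0 y : 0 <= e y * gamma_density alpha (p * t) y.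
  by rewrite mulr_ge0 ?expR_ge0 ?gamma_density_ge0.
rewrite lawG//; apply: (@le_trans _ _ (\int[mu]_(y in A `&` `]0%R, +oo[)
    ((expR (- K))%:E * (e y * gamma_density alpha (p * t) y)%:E))%E).
  apply: ge0_le_integral => //.
  - by move=> y _; rewrite lee_fin gamma_density_ge0.
  - by apply/measurable_EFinP; exact: measurable_gamma_density.
  - apply: (emeasurable_funM (f := cst (expR (- K))%:E)) => //.
    by apply/measurable_EFinP; exact: mge.
  move=> y [Ay]; rewrite /= in_itv/= andbT => y0; rewrite -EFinM lee_fin mulrA.
  rewrite ler_peMl ?gamma_density_ge0// -expRD; apply: le_trans (expR_ge1Dx _).
  rewrite lerDl addrC subr_ge0.
  exact: AK.
rewrite ge0_integralZl//=; last 2 first.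
- by apply/measurable_EFinP; exact: mge.
- by move=> y _; rewrite lee_fin.
rewrite EFinM lee_pmul2l//; last by rewrite lte_fin expR_gt0.
apply: (@le_trans _ _ (\int[mu]_(y in `]0%R, +oo[) (e y * gamma_density alpha (p * t) y)%:E)%E).
  apply: ge0_subset_integral => //.
  - by apply/measurable_EFinP; exact: mge.
  - by move=> y _; rewrite lee_fin.
rewrite integral_gamma_density_tilt//.
have := lawG _ t0 setT measurableT; rewrite setTI preimage_setT probability_setT => <-.
by rewrite mule1.
Qed.

End gamma.

(** Both tails come from [gamma_chernoff], with c = 2 and c = 1 / 2; the factors
    4 leave room for the crude bounds 2 <= e and 1 / 2 <= exp (- 1 / 2). *)
Lemma gamma_concentration (R : realType) (alpha p : R) d (T : measurableType d)
    (P : probability T R) (G : R -> {RV P >-> R}) (t : R) :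
  0 < alpha -> 0 < p -> gamma_process alpha p G -> 0 < t ->
  (P [set w | ~~ (p / (4 * alpha) * t <= G t w < 4 * p / alpha * t)%R] <=
   (2 * expR (- (p / 4 * t)))%:E)%E.
Proof.
move=> alpha0 p0 gammaG t0; have pt0 : 0 < p * t by exact: mulr_gt0.
set g0 := p / _; set g1 := 4 * p / _.
have [e2 _ _] := @expR1_bounds R.
have eh : 2^-1 <= expR (- 2^-1) :> R by have := expR_ge1Dx (- 2^-1 : R); lra.
have lo : (P (G t @^-1` `]-oo, (g0 * t)%R[%classic) <= (expR (- (p / 4 * t)))%:E)%E.
  have c0 : 0 < 2^-1 :> R by [].
  apply: le_trans (gamma_chernoff (K := - (p / 4 * t)) gammaG t0 c0 _ _) _ => //.
    move=> y; rewrite /= in_itv/= invrK => yg _.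
    have : alpha * y <= alpha * (g0 * t) by rewrite ler_pM2l// ltW.
    have -> : alpha * (g0 * t) = p / 4 * t by rewrite /g0; field; rewrite gt_eqF.
    lra.
  rewrite lee_fin opprK.
  apply: (@le_trans _ _ (expR (p / 4 * t) * expR (- 2^-1 * (p * t)))).
    by rewrite ler_pM2l ?expR_gt0// expRM ge0_ler_powR ?nnegrE ?(ltW pt0)// expR_ge0.
  by rewrite -expRD ler_expR; lra.
have hi : (P (G t @^-1` `[(g1 * t)%R, +oo[%classic) <= (expR (- (p / 4 * t)))%:E)%E.
  have c0 : 0 < 2 :> R by [].
  apply: le_trans (gamma_chernoff (K := 2 * (p * t)) gammaG t0 c0 _ _) _ => //.
    move=> y; rewrite /= in_itv/= andbT => yg _.
    have : alpha * (g1 * t) <= alpha * y by rewrite ler_pM2l.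
    have -> : alpha * (g1 * t) = 4 * p * t by rewrite /g1; field; rewrite gt_eqF.
    lra.
  rewrite lee_fin.
  apply: (@le_trans _ _ (expR (- (2 * (p * t))) * expR (1 * (p * t)))).
    by rewrite ler_pM2l ?expR_gt0// expRM ge0_ler_powR ?nnegrE ?(ltW pt0)// expR_ge0.
  by rewrite -expRD ler_expR; lra.
rewrite mulrDl mul1r EFinD; apply: le_trans (leeD lo hi).
have mlo : measurable (G t @^-1` `]-oo, g0 * t[%classic) by exact: measurable_funPTI.
have mhi : measurable (G t @^-1` `[g1 * t, +oo[%classic) by exact: measurable_funPTI.
apply: le_trans (measureU2 _ mlo mhi).
rewrite le_measure ?inE//.
- exact: measurable_outside.
- exact: measurableU.
by move=> w /=; rewrite negb_and -ltNge -leNgt !in_itv/= andbT => /orP[];[left|right].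
Qed.

(** * Concentration of the Poisson distribution *)

Section poisson.
Context {R : realType}.
Implicit Types (r : R) (k n : nat).

Lemma sum_poisson_pmf_le1 r n : 0 < r -> \sum_(k < n) poisson_pmf r k <= 1.
Proof.
move=> r0.
rewrite (eq_bigr (fun k : 'I_n => r ^+ k / k`!%:R * expR (- r))); last first.
  by move=> k _; rewrite /poisson_pmf r0.
rewrite -big_distrl /= -ler_pdivlMr ?expR_gt0// div1r expRN invrK.
have := nondecreasing_cvgn_le _ (is_cvg_series_exp_coeff r) n.
rewrite /series/= big_mkord; apply.
by apply: nondecreasing_series => k _ _; rewrite /exp_coeff/= divr_ge0 ?exprn_ge0 ?ltW.
Qed.

Lemma cvg_sum_poisson_pmf r : 0 < r ->
  (fun n => \sum_(k < n) poisson_pmf r k) @ \oo --> (1 : R).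
Proof.
move=> r0; rewrite -(expRxMexpNx_1 r).
have -> : (fun n => \sum_(k < n) poisson_pmf r k) =
    (fun n => series (exp_coeff r) n * expR (- r)).
  apply/funext => n; rewrite /series/= big_mkord big_distrl/=.
  by apply: eq_bigr => k _; rewrite /poisson_pmf r0.
by apply: cvgM; [exact: is_cvg_series_exp_coeff|exact: cvg_cst].
Qed.

Lemma poisson_pmf_tilt r c k : 0 < r -> 0 < c ->
  poisson_pmf r k = c ^- k * expR (c * r - r) * poisson_pmf (c * r) k.
Proof.
move=> r0 c0; rewrite /poisson_pmf r0 mulr_gt0// exprMn expRB !expRN.
by field; rewrite pnatr_eq0 -lt0n fact_gt0/= !gt_eqF ?exprn_gt0 ?expR_gt0.
Qed.

(** Chernoff bound term by term: changing the rate by a factor e or 1 / e costs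
    at most exp (- r / 4) away from the typical range, and leaves a summable
    family. *)
Lemma poisson_pmf_far r k : 0 < r ->
  ~~ (r / 4 <= k%:R < 4 * r) ->
  poisson_pmf r k <= expR (- (r / 4)) *
    (poisson_pmf (expR 1 * r) k + poisson_pmf (expR (- 1) * r) k).
Proof.
move=> r0; have [e2 e4 eh] := @expR1_bounds R.
rewrite negb_and -ltNge -leNgt mulrDr => /orP[kr|rk].
- rewrite (@poisson_pmf_tilt _ (expR (- 1)) _ r0) ?expR_gt0//.
  apply: ler_wpDl; first by rewrite mulr_ge0 ?expR_ge0 ?poisson_pmf_ge0.
  apply: ler_wpM2r; first exact: poisson_pmf_ge0.
  rewrite -expRM_natl -expRN -expRD ler_expR.
  have : expR (- 1) * r <= 2^-1 * r.
    by rewrite ler_pM2r.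
  by move: kr; move: (k%:R : R) => K; lra.
- rewrite (@poisson_pmf_tilt _ (expR 1) _ r0) ?expR_gt0//.
  apply: ler_wpDr; first by rewrite mulr_ge0 ?expR_ge0 ?poisson_pmf_ge0.
  apply: ler_wpM2r; first exact: poisson_pmf_ge0.
  rewrite -expRM_natl -expRN -expRD ler_expR.
  have : expR 1 * r <= 4 * r by rewrite ler_pM2r.
  by move: rk; move: (k%:R : R) => K; lra.
Qed.

Lemma poisson_concentration d (T : measurableType d) (P : probability T R)
    (X : {RV P >-> R}) r : 0 < r ->
  (forall k, P (X @^-1` [set k%:R]) = (poisson_pmf r k)%:E) ->
  (P [set w | ~~ (r / 4 <= X w < 4 * r)]%R <= (2 * expR (- (r / 4)))%:E)%E.
Proof.
move=> r0 lawX.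
pose I := `[r / 4, 4 * r[%classic : set R.
have mI : measurable (X @^-1` I) by apply: measurable_funPTI; exact: measurable_itv.
have -> : [set w | ~~ (r / 4 <= X w < 4 * r)] = ~` (X @^-1` I).
  by apply/seteqP; split => w; rewrite /I /= in_itv/= => /negP.
rewrite probability_setC//.
pose good k := r / 4 <= k%:R < 4 * r.
pose F k : set T := if good k then X @^-1` [set k%:R] else set0.
have mF k : measurable (F k).
  by rewrite /F; case: ifP => // _; exact: measurable_funPTI.
have tF : trivIset setT F.
  apply/trivIsetP => i j _ _ ij; apply/seteqP; split => // w [].
  rewrite /F; case: ifP => // _; case: ifP => // _ /= -> /eqP.
  by rewrite eqr_nat (negPf ij).
have le n : (\sum_(k < n) poisson_pmf r k - 2 * expR (- (r / 4)) <= fine (P (X @^-1` I)))%R.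
  rewrite -lee_fin fineK; last exact: fin_num_measure.
  apply: (@le_trans _ _ (P (\big[setU/set0]_(k < n) F k))); last first.
    apply: le_measure; rewrite ?inE; [exact: bigsetU_measurable|exact: mI|].
    by rewrite -bigcup_mkord => w [k _]; rewrite /F; case: ifP => // gk /= Xk;
      rewrite /I /= in_itv/= Xk.
  rewrite measure_bigsetU//.
  have -> : (\sum_(k < n) P (F k) =
      (\sum_(k < n) (if good k then poisson_pmf r k else 0))%:E)%E.
    rewrite -sumEFin; apply: eq_bigr => k _; rewrite /F.
    by case: ifP => _; rewrite ?lawX ?measure0.
  rewrite lee_fin lerBlDr.
  have e0 c : 0 < expR c * r :> R by rewrite mulr_gt0 ?expR_gt0.
  apply: (@le_trans _ _ (\sum_(k < n) ((if good k then poisson_pmf r k else 0) +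
      expR (- (r / 4)) * (poisson_pmf (expR 1 * r) k + poisson_pmf (expR (- 1) * r) k)))).
    apply: ler_sum => k _; case: ifPn => gk.
      by rewrite lerDl mulr_ge0 ?expR_ge0 ?addr_ge0 ?poisson_pmf_ge0.
    by rewrite add0r poisson_pmf_far.
  rewrite big_split /= lerD2l -mulr_sumr big_split /= mulrC ler_wpM2r ?expR_ge0//.
  by rewrite -[2]/(1 + 1) lerD// sum_poisson_pmf_le1.
have : 1 - 2 * expR (- (r / 4)) <= fine (P (X @^-1` I)).
  have cv : \sum_(k < n) poisson_pmf r k - 2 * expR (- (r / 4)) @[n --> \oo] -->
      1 - 2 * expR (- (r / 4)).
    by apply: cvgB; [exact: cvg_sum_poisson_pmf|exact: cvg_cst].
  rewrite -(cvg_lim _ cv)//; apply: limr_le; first by apply/cvg_ex; eexists; exact: cv.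
  by apply: nearW => n; exact: le.
rewrite -lee_fin fineK; last exact: fin_num_measure.
rewrite EFinB => H; rewrite leeBlDr; last exact: fin_num_measure.
by rewrite -leeBlDl.
Qed.

End poisson.

(** * Tails of the stable subordinator *)

Section stable.
Context {R : realType} d (T : measurableType d) (P : probability T R).
Context (beta : R) (D : R -> {RV P >-> R}) (stD : stable_subordinator beta D).

Let mexpD u s : measurable_fun setT (fun w => expR (- (u * D s w))).
Proof.
by apply: measurableT_comp => //; apply: measurableT_comp => //; exact: measurable_funM.
Qed.

Lemma stable_subordinator_ge0 s w : 0 <= s -> 0 <= D s w.
Proof. by move=> s0; have [[D0 ndD _ _ _] _] := stD; rewrite -(D0 w) ndD. Qed.

(** Chernoff bound from the Laplace transform at u. *)
Lemma stable_subordinator_le u s y : 0 <= u -> 0 <= s ->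
  (P [set w | (D s w <= y)%R] <= (expR (u * y - s * u `^ beta))%:E)%E.
Proof.
move=> u0 s0; have [_ /(_ _ _ u0 s0)] := stD; rewrite expectation.unlock => LD.
have mA : measurable [set w | D s w <= y] by exact: measurable_le.
rewrite expRD EFinM -LD -ge0_integralZl//=; last first.
  by apply/measurable_EFinP; exact: mexpD.
rewrite -[X in P X]setIT -integral_indic//.
apply: ge0_le_integral => //.
- by apply/measurable_EFinP; exact: measurable_indic.
- apply: (emeasurable_funM (f := cst (expR (u * y))%:E)) => //.
  by apply/measurable_EFinP; exact: mexpD.
move=> w _; rewrite -EFinM lee_fin indicE.
have [/set_mem/= Dy|_] := boolP (w \in _); last by rewrite mulr_ge0// expR_ge0.
rewrite -expRD; apply: le_trans (expR_ge1Dx _).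
by rewrite lerDl subr_ge0 ler_wpM2l.
Qed.

(** As u y >= 1, on this event exp (- u D s) is at most 1 / e <= 1 / 2, whereas
    its mean 1 - O(s u ^ beta) is close to 1 for small s. *)
Lemma stable_subordinator_gt u s y : 0 <= u -> 0 <= s -> 1 <= u * y ->
  (P [set w | (y < D s w)%R] <= (2 * (s * u `^ beta))%:E)%E.
Proof.
move=> u0 s0 uy; have [_ /(_ _ _ u0 s0)] := stD; rewrite expectation.unlock => LD.
set A := [set w | y < D s w]; have mA : measurable A by exact: measurable_gt.
have : (\int[P]_w ((expR (- (u * D s w)))%:E + (2^-1)%:E * (\1_A w)%:E) <= 1)%E.
  rewrite -(probability_setT P) -[leRHS]mul1e -integral_cst//.
  apply: ge0_le_integral => //.
  - by move=> w _; rewrite -EFinM -EFinD lee_fin addr_ge0 ?expR_ge0 ?mulr_ge0.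
  - apply: emeasurable_funD; first by apply/measurable_EFinP; exact: mexpD.
    apply: (emeasurable_funM (f := cst (2^-1)%:E)) => //.
    by apply/measurable_EFinP; exact: measurable_indic.
  move=> w _; rewrite -EFinM -EFinD lee_fin indicE.
  have [/set_mem/= Dy|_] := boolP (w \in _).
    rewrite mulr1; apply: (@le_trans _ _ (expR (- 1) + 2^-1)).
      by rewrite lerD2r ler_expR lerN2 (le_trans uy)// ler_wpM2l// ltW.
    by have [_ _] := @expR1_bounds R; lra.
  by rewrite mulr0 addr0 -expR0 ler_expR oppr_le0 mulr_ge0// stable_subordinator_ge0.
rewrite ge0_integralD//=; last 2 first.
- by apply/measurable_EFinP; exact: mexpD.
- apply: (emeasurable_funM (f := cst (2^-1)%:E)) => //.
  by apply/measurable_EFinP; exact: measurable_indic.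
rewrite LD ge0_integralZl//=; last first.
  by apply/measurable_EFinP; exact: measurable_indic.
have solve (a : R) (x : \bar R) : (a%:E + (2^-1)%:E * x <= 1)%E -> (x <= (2 * (1 - a))%:E)%E.
  case: x => [q| |]; rewrite ?leNye//.
    by rewrite -EFinM -EFinD !lee_fin => ?; lra.
  by rewrite gt0_muley ?lte_fin// addey.
rewrite integral_indic// setIT => /solve/le_trans; apply.
rewrite lee_fin; have := expR_ge1Dx (- (s * u `^ beta)); lra.
Qed.

End stable.

(** * The Poisson process at the inverse stable time *)

Section fpp.
Context {R : realType} d (T : measurableType d) (P : probability T R).
Context (beta lambda : R) (N D : R -> {RV P >-> R}) (lambda0 : 0 < lambda).
Context (poN : poisson_process lambda N) (stD : stable_subordinator beta D).
Local Notation E y w := (inverse_subordinator (fun s => D s) y w).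

Let ndD w s t : 0 <= s -> s <= t -> D s w <= D t w.
Proof. by case: stD => -[_ ndD _ _ _] _; exact: ndD. Qed.

Let ndN w s t : 0 <= s -> s <= t -> N s w <= N t w.
Proof. by case: poN => -[_ ndN _ _ _] _; exact: ndN. Qed.

Lemma inverse_subordinator_ge0 y w : 0 <= E y w.
Proof.
rewrite /inverse_subordinator; set S := [set s | _].
have [->|/set0P S0] := eqVneq S set0; first by rewrite inf0.
by apply: lb_le_inf => // s [/ltW].
Qed.

Lemma inverse_subordinator_gt y s w : 0 < s -> s < E y w -> D s w <= y.
Proof.
move=> s0; apply: contraTT; rewrite -ltNge -leNgt => ys.
by apply: ge_inf => //; exists 0 => r [/ltW].
Qed.

(** The second alternative is the case of a bounded path, where the infimum is
    taken over the empty set and equals 0. *)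
Lemma inverse_subordinator_lt y s w : 0 < s ->
  E y w < s <-> (exists2 r, 0 < r < s & y < D r w) \/ (forall n : nat, D n%:R w <= y).
Proof.
move=> s0; set S := [set r | 0 < r /\ y < D r w]; split.
  have [S0 _|/set0P S0 /(inf_lt S0)[r [r0 yr] rs]] := eqVneq S set0; last first.
    by left; exists r => //; rewrite r0.
  right => n; rewrite leNgt; apply/negP => yn.
  have : S n.+1%:R.
    by split; [rewrite ltr0n|rewrite (lt_le_trans yn)// ndD// ler_nat].
  by rewrite S0.
case=> [[r /andP[r0 rs] yr]|yn].
  apply: le_lt_trans rs; apply: ge_inf => //; by exists 0 => u [/ltW].
rewrite /inverse_subordinator (_ : [set _ | _] = set0) ?inf0//.
apply/seteqP; split => // r [r0 yr].
have := lt_le_trans yr (ndD w (ltW r0) (ltW (archi_boundP (ltW r0)))).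
by move/lt_le_trans => /(_ _ (yn _)); rewrite ltxx.
Qed.

Lemma measurable_inverse_subordinator_lt y s :
  measurable [set w | E y w < s].
Proof.
have [s0|s0] := ltP 0 s; last first.
  rewrite (_ : [set _ | _] = set0)//; apply/seteqP; split => // w /=.
  by rewrite ltNge (le_trans s0)// inverse_subordinator_ge0.
rewrite (_ : [set w | E y w < s] =
  (\bigcup_(q in [set: rat]) (if (0 < (ratr q : R) < s)%R
                              then [set w | y < D (ratr q) w] else set0))
  `|` \bigcap_n [set w | D n%:R w <= y]).
  apply: measurableU.
    apply: bigcupT_measurable_rat => q; case: ifP => // _; exact: measurable_gt.
  by apply: bigcap_measurable => // n _; exact: measurable_le.
apply/seteqP; split => w /=; rewrite inverse_subordinator_lt//.
  move=> [[r /andP[r0 rs] yr]|yn]; last by right => n _; exact: yn.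
  have [q] := rat_in_itvoo rs; rewrite in_itv/= => /andP[rq qs].
  left; exists q => //; rewrite (lt_trans r0 rq) qs/=.
  by rewrite (lt_le_trans yr)// ndD// ltW.
move=> [[q _]|yn]; last by right => n; exact: (yn n I).
by case: ifP => // qs yq; left; exists (ratr q).
Qed.

(** As paths of N are nondecreasing and right-continuous, N (E y) < A means that
    N q < A for some rational q > E y. *)
Lemma measurable_time_change_lt y A : measurable [set w | N (E y w) w < A].
Proof.
rewrite (_ : [set w | N (E y w) w < A] = \bigcup_(q in [set: rat])
    ([set w | E y w < ratr q] `&` [set w | N (ratr q) w < A])).
  apply: bigcupT_measurable_rat => q; apply: measurableI.
    exact: measurable_inverse_subordinator_lt.
  exact: measurable_lt.
apply/seteqP; split => w /=; last first.
  move=> [q _ [Eq Nq]]; apply: le_lt_trans Nq; apply: ndN => //; last exact: ltW.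
  exact: inverse_subordinator_ge0.
move=> NA; have [[_ _ rcN _ _] _] := poN.
have : \forall s \near (E y w)^'+, N s w < A.
  have An : nbhs (N (E y w) w) [set v | v < A] by exact: lt_nbhsl.
  exact: (rcN w _ (inverse_subordinator_ge0 y w) _ An).
move=> /at_right_itv[e e0 He].
have [q] : exists q : rat, ratr q \in `]E y w, (E y w + e)%R[.
  by apply: rat_in_itvoo; rewrite ltrDl.
by rewrite in_itv/= => qI; exists q => //; split; [case/andP: qI|exact: He].
Qed.

Lemma measurable_time_change y : measurable_fun setT (fun w => N (E y w) w).
Proof.
apply: (measurability (@RGenInftyO.G R)); first exact: RGenInftyO.measurableE.
move=> _ [_ [x ->] <-]; rewrite setTI.
rewrite (_ : _ @^-1` _ = [set w | N (E y w) w < x]).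
  exact: measurable_time_change_lt.
by apply/seteqP; split => w /=; rewrite in_itv.
Qed.

Local Notation far s := [set w | ~~ (lambda * s / 4 <= N s w < 4 * (lambda * s))].

Let mfar s : measurable (far s).
Proof. exact: measurable_outside. Qed.

Let Pfar s : 0 < s -> (P (far s) <= (2 * expR (- (lambda * s / 4)))%:E)%E.
Proof.
move=> s0; apply: poisson_concentration; first by rewrite mulr_gt0.
by case: poN => _; exact.
Qed.

(** Either E y > s, which forces D s <= y, or N (E y) <= N s by monotonicity, and
    then N s is atypically large. *)
Lemma time_change_upper_tail y s u : 0 < s -> 0 <= u ->
  (P [set w | (4 * (lambda * s) <= N (E y w) w)%R] <=
   (expR (u * y - s * u `^ beta) + 2 * expR (- (lambda * s / 4)))%:E)%E.
Proof.
move=> s0 u0.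
have mle : measurable [set w | D s w <= y] by exact: measurable_le.
apply: le_trans (leeD (stable_subordinator_le stD y u0 (ltW s0)) (Pfar s0)).
apply: le_trans (measureU2 _ mle (mfar s)).
rewrite le_measure ?inE//; last 2 first.
- exact: measurableU.
- move=> w /= NE; have [Ds|yD] := leP (D s w) y; [by left|right].
  apply/negP => /andP[_ Ns].
  have : s < E y w.
    rewrite ltNge; apply/negP => Es; move: NE; rewrite leNgt => /negP; apply.
    by apply: le_lt_trans Ns; apply: ndN => //; exact: inverse_subordinator_ge0.
  by move=> /(inverse_subordinator_gt s0); rewrite leNgt yD.
rewrite (_ : [set _ | _] = ~` [set w | N (E y w) w < 4 * (lambda * s)]).
  by apply: measurableC; exact: measurable_time_change_lt.
by apply/seteqP; split => w /=; rewrite leNgt => /negP.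
Qed.

(** If E y >= s then N s <= N (E y) is atypically small.  Otherwise D s > y or
    the path of D never exceeds y; the latter event has probability at most
    exp (u y - r u ^ beta) for every r, hence 0. *)
Lemma time_change_lower_tail y s u : 0 < s -> 0 < u -> 1 <= u * y ->
  (P [set w | (N (E y w) w < lambda * s / 4)%R] <=
   (2 * (s * u `^ beta) + 2 * expR (- (lambda * s / 4)))%:E)%E.
Proof.
move=> s0 u0 uy.
set x := P _; set a := 2 * _ + _.
have mX := measurable_time_change_lt y (lambda * s / 4).
have ub0 : 0 < u `^ beta by exact: powR_gt0.
have main r : 0 <= r -> (x <= (a + expR (u * y - r * u `^ beta))%:E)%E.
  move=> r0.
  have mgt : measurable [set w | y < D s w] by exact: measurable_gt.
  have mle : measurable [set w | D r w <= y] by exact: measurable_le.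
  apply: le_trans (leeD (leeD (stable_subordinator_gt stD (ltW u0) (ltW s0) uy) (Pfar s0))
     (stable_subordinator_le stD y (ltW u0) r0)).
  apply: le_trans (leeD (measureU2 _ mgt (mfar s)) (lexx _)).
  apply: le_trans (measureU2 _ (measurableU _ _ mgt (mfar s)) mle).
  rewrite le_measure ?inE//.
    by apply: measurableU => //; exact: measurableU.
  move=> w /= NE; have [yD|Ds] := ltP y (D s w); first by left; left.
  have [Dr|yr] := leP (D r w) y; [by right|left; right].
  apply/negP => /andP[Ns _].
  have : ~ (s <= E y w).
    move=> sE; move: NE; rewrite ltNge => /negP; apply; apply: le_trans Ns _.
    by apply: ndN => //; exact: ltW.
  move/negP; rewrite -ltNge inverse_subordinator_lt// => -[[v /andP[v0 vs] yv]|yn].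
    have := lt_le_trans yv (ndD w (ltW v0) (ltW vs)).
    by rewrite ltNge Ds.
  have := lt_le_trans yr (ndD w r0 (ltW (archi_boundP r0))).
  by move/lt_le_trans => /(_ _ (yn _)); rewrite ltxx.
have xfin : x \is a fin_num by exact: fin_num_measure.
rewrite -(fineK xfin) lee_fin; apply/ler_addgt0Pr => e e0.
(* This r makes the exponent equal to - 1 / e, and exp (- 1 / e) <= e. *)
have r0 : 0 <= (u * y + e^-1) / u `^ beta.
  by rewrite divr_ge0 ?powR_ge0// addr_ge0 ?invr_ge0 ?ltW// (lt_le_trans _ uy).
have := main _ r0; rewrite divfK ?gt_eqF// -(fineK xfin) lee_fin => /le_trans; apply.
rewrite lerD2l opprD addrA subrr add0r expRN invf_ple ?posrE ?expR_gt0//.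
by apply: le_trans (expR_ge1Dx _); rewrite lerDr.
Qed.

End fpp.

(** * A right-continuous process at an independent random time *)

Section random_time.
Context {R : realType} d (T : measurableType d) (P : probability T R).
Context (X : R -> {RV P >-> R}) (G : {RV P >-> R}).
Context (rcX : right_continuous_paths (fun s => X s)).
Context (indXG : forall s, 0 <= s -> forall A B : set R,
  measurable A -> measurable B ->
  P (X s @^-1` A `&` G @^-1` B) = (P (X s @^-1` A) * P (G @^-1` B))%E).

(** Round G up to a grid of [a, b].  On each cell the time is deterministic, so
    independence bounds the probability at the rounded time by q.  As the mesh
    tends to 0 the rounded time decreases to G from the right, so
    right-continuity and openness of O put the event at G in the increasing
    union of the events that it occurs at all fine enough rounded times. *)
Lemma independent_time (O : set R) (a b q : R) :
  open O -> 0 <= a -> a < b ->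
  measurable [set w | O (X (G w) w)] ->
  (forall s, a <= s <= b -> (P (X s @^-1` O) <= q%:E)%E) ->
  (P [set w | O (X (G w) w)] <= q%:E + P [set w | ~~ (a <= G w < b)%R])%E.
Proof.
move=> oO a0 ab mO Pq.
have mOR : measurable O by exact: open_measurable.
have mXO s : measurable (X s @^-1` O) by exact: measurable_funPTI.
have q0 : 0 <= q.
  rewrite -lee_fin; apply: le_trans (Pq a _); first exact: measure_ge0.
  by rewrite lexx ltW.
pose dlt m : R := (b - a) / m.+1%:R.
have dlt0 m : 0 < dlt m by rewrite divr_gt0 ?subr_gt0 ?ltr0n.
have dltE m : m.+1%:R * dlt m = b - a by rewrite mulrC divfK ?pnatr_eq0.
(* Cell k of the grid of mesh (b - a) / (m + 1), and the event that G falls in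
   it while X at the right end of the cell lies in O. *)
pose I m k : set R := `[a + k%:R * dlt m, a + k.+1%:R * dlt m[%classic.
pose C m k := X (a + k.+1%:R * dlt m) @^-1` O `&` G @^-1` I m k.
have mGI m k : measurable (G @^-1` I m k).
  by apply: measurable_funPTI; exact: measurable_itv.
have mC m k : measurable (C m k) by exact: measurableI.
pose A m := \big[setU/set0]_(k < m.+1) C m k.
have mA m : measurable (A m) by apply: bigsetU_measurable.
have tI m : trivIset setT (fun k => G @^-1` I m k).
  apply: ltn_trivIset => i j ij; apply/seteqP; split => // w [] /=.
  rewrite /I /= !in_itv/= => /andP[_ h1] /andP[h2 _].
  have := le_lt_trans h2 h1.
  by rewrite ltrD2l ltr_pM2r// ltr_nat ltnS leqNgt ij.
have PA m : (P (A m) <= q%:E)%E.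
  apply: le_trans (Boole_inequality P (n := m.+1) (fun k _ => mC m k)) _.
  apply: (@le_trans _ _ (\sum_(k < m.+1) (q%:E * P (G @^-1` I m k)))%E).
    have y0 k : 0 <= a + k.+1%:R * dlt m by rewrite addr_ge0// mulr_ge0// ltW.
    apply: lee_sum => k _.
    apply: (@le_trans _ _ (P (X (a + k.+1%:R * dlt m) @^-1` O) * P (G @^-1` I m k))%E).
      by rewrite -indXG//; exact: measurable_itv.
    apply: lee_wpmul2r; first exact: measure_ge0.
    apply: Pq; rewrite lerDl mulr_ge0 ?(ltW (dlt0 m))//= -lerBrDl -(dltE m).
    by rewrite ler_pM2r// ler_nat.
  rewrite -ge0_sume_distrr; last by move=> k _; exact: measure_ge0.
  rewrite -(measure_bigsetU P (mGI m) (tI m)) -[leRHS]mule1.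
  apply: lee_wpmul2l => //; apply: probability_le1.
  exact: bigsetU_measurable.
(* The event occurs at the rounded time for every mesh index m >= M. *)
pose B M := \bigcap_(m in [set m | (M <= m)%N]) A m.
have mB M : measurable (B M) by apply: bigcap_measurable => //; exists M => /=.
have PB M : (P (B M) <= q%:E)%E.
  apply: le_trans (PA M); rewrite le_measure ?inE// => w; apply => /=.
  exact: leqnn.
have ndB : {homo B : n m / (n <= m)%N >-> (n <= m)%O}.
  move=> n m nm; apply/subsetPset => w Bw k /= mk; apply: Bw => /=.
  exact: leq_trans nm mk.
have mUB : measurable (\bigcup_M B M) by exact: bigcup_measurable.
have PUB : (P (\bigcup_M B M) <= q%:E)%E.
  have cv := nondecreasing_cvg_mu (mu := P) mB mUB ndB.
  rewrite -(cvg_lim _ cv)//; apply: lime_le; first by apply/cvg_ex; eexists; exact: cv.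
  by apply: nearW => M; exact: PB.
have mN : measurable [set w | ~~ (a <= G w < b)] by exact: measurable_outside.
apply: le_trans (leeD PUB (lexx _)).
apply: le_trans (measureU2 _ mUB mN).
rewrite le_measure ?inE//; first exact: measurableU.
move=> w /= Ow; have [/andP[aG Gb]|] := boolP (a <= G w < b); [left|by right].
have G0 : 0 <= G w by exact: le_trans aG.
have : \forall s \near (G w)^'+, O (X s w).
  have On : nbhs (X (G w) w) O by apply: open_nbhs_nbhs.
  exact: (rcX G0 On).
move=> /at_right_itv[e e0 He].
have ba0 : 0 <= (b - a) / e by rewrite divr_ge0 ?subr_ge0 ?ltW.
exists (Num.bound ((b - a) / e)) => // m /= Mm.
have dm : dlt m < e.
  rewrite /dlt ltr_pdivrMr ?ltr0n// mulrC -ltr_pdivrMr//.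
  apply: lt_le_trans (archi_boundP ba0) _; rewrite ler_nat.
  exact: leq_trans Mm (leqnSn m).
pose z := (G w - a) / dlt m.
have z0 : 0 <= z by rewrite divr_ge0 ?subr_ge0// ltW.
have /andP[k1 k2] := truncn_itv z0; set k := Num.trunc z in k1 k2.
have zE : G w = a + z * dlt m by rewrite /z divfK ?gt_eqF// addrC subrK.
have km : (k < m.+1)%N.
  rewrite -(ltr_nat R) (le_lt_trans k1)// /z ltr_pdivrMr// dltE.
  by rewrite ltrD2r.
rewrite /A -bigcup_mkord; exists k => //; split; last first.
  by rewrite /I /= in_itv/= zE lerD2l ltrD2l ler_pM2r// ltr_pM2r// k1.
apply: He; rewrite zE ltrD2l ltr_pM2r// k2/= -addrA ltrD2l -natr1 mulrDl mul1r.
by rewrite ler_ltD// ler_pM2r.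
Qed.

End random_time.

(** * Tails of the fractional Poisson process *)

Section fractional_poisson.
Context {R : realType} (beta lambda : R) d (T : measurableType d).
Context (P : probability T R) (Nb : R -> {RV P >-> R}).
Context (lambda0 : 0 < lambda).
Context (fppNb : fractional_poisson_process beta lambda Nb).

Lemma fpp_upper_tail y s u : 0 <= y -> 0 < s -> 0 <= u ->
  (P [set w | (4 * (lambda * s) < Nb y w)%R] <=
   (expR (u * y - s * u `^ beta) + 2 * expR (- (lambda * s / 4)))%:E)%E.
Proof.
move=> y0 s0 u0; case: fppNb => _ [d' [T' [P' [N [D [poN stD _ law]]]]]].
have mN := measurable_time_change poN stD y.
apply: le_trans (time_change_upper_tail lambda0 poN stD y s0 u0).
have := law y y0 _ (measurable_gt (@measurable_id _ _ setT) (4 * (lambda * s))).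
rewrite /preimage /= => ->; rewrite le_measure ?inE//.
- exact: (measurable_gt mN).
- exact: (measurable_ge mN).
- by move=> w /= /ltW.
Qed.

Lemma fpp_lower_tail y s u : 0 <= y -> 0 < s -> 0 < u -> 1 <= u * y ->
  (P [set w | (Nb y w < lambda * s / 4)%R] <=
   (2 * (s * u `^ beta) + 2 * expR (- (lambda * s / 4)))%:E)%E.
Proof.
move=> y0 s0 u0 uy; case: fppNb => _ [d' [T' [P' [N [D [poN stD _ law]]]]]].
apply: le_trans (time_change_lower_tail lambda0 poN stD s0 u0 uy).
have := law y y0 _ (measurable_lt (@measurable_id _ _ setT) (lambda * s / 4)).
by rewrite /preimage /= => ->.
Qed.

(** The marginals of Nb are only known through their laws, so that negativity is
    excluded almost surely rather than pathwise. *)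
Lemma fpp_ge0 y : 0 <= y -> P [set w | Nb y w < 0] = 0%E.
Proof.
move=> y0; case: fppNb => _ [d' [T' [P' [N [D [poN stD _ law]]]]]].
have := law y y0 _ (measurable_lt (@measurable_id _ _ setT) 0).
rewrite /preimage /= => ->.
rewrite [X in P' X](_ : _ = set0) ?measure0//; apply/seteqP; split => // w /=.
rewrite ltNge => /negP; apply; have [[N0 ndN _ _ _] _] := poN.
by rewrite -(N0 w); apply: ndN => //; exact: inverse_subordinator_ge0.
Qed.

End fractional_poisson.

(** * Tails of the fractional negative binomial process *)

Section fnbp.
Context {R : realType} (beta alpha p lambda : R).
Context (alpha0 : 0 < alpha) (p0 : 0 < p) (lambda0 : 0 < lambda).
Context d (T : measurableType d) (P : probability T R).
Context (Q Nb G : R -> {RV P >-> R}).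
Context (fppNb : fractional_poisson_process beta lambda Nb).
Context (gammaG : gamma_process alpha p G).
Context (indNbG : independent_processes P (fun t => Nb t) (fun t => G t)).
Context (QE : forall t, 0 <= t -> forall w, Q t w = Nb (G t w) w).

Lemma fnbp_window t (O : set R) a b q : 0 <= t -> open O -> 0 <= a -> a < b ->
  (forall s, a <= s <= b -> (P [set w | O (Nb s w)] <= q%:E)%E) ->
  (P [set w | O (Q t w)] <= q%:E + P [set w | ~~ (a <= G t w < b)%R])%E.
Proof.
move=> t0 oO a0 ab Hq.
have rcNb : right_continuous_paths (fun t => Nb t) by case: fppNb.
have QO : [set w | O (Q t w)] = [set w | O (Nb (G t w) w)].
  by apply/seteqP; split => w /=; rewrite QE.
have mQ : measurable [set w | O (Q t w)].
  by apply: (measurable_funPTI (Q t)); exact: open_measurable.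
rewrite QO; apply: (independent_time rcNb _ oO a0 ab _ Hq); last by rewrite -QO.
move=> s s0 A B mA mB.
have := @indNbG 1%N 1%N (fun=> s) (fun=> t) (fun=> A) (fun=> B)
  (fun=> s0) (fun=> t0) (fun=> mA) (fun=> mB).
rewrite /= (_ : [set w | forall i : 'I_1, A (Nb s w)] = Nb s @^-1` A); last first.
  by apply/seteqP; split => w //=; apply; exact: ord0.
rewrite (_ : [set w | forall i : 'I_1, B (G t w)] = G t @^-1` B)//.
by apply/seteqP; split => w //=; apply; exact: ord0.
Qed.

Local Notation g0 := (p / (4 * alpha)).
Local Notation g1 := (4 * p / alpha).

Lemma fnbp_typical_window t (O : set R) q : 0 < t -> open O ->
  (forall s, g0 * t <= s <= g1 * t -> (P [set w | O (Nb s w)] <= q%:E)%E) ->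
  (P [set w | O (Q t w)] <= (q + 2 * expR (- (p / 4 * t)))%:E)%E.
Proof.
move=> t0 oO Hq; rewrite EFinD.
apply: le_trans (leeD (lexx _) (gamma_concentration alpha0 p0 gammaG t0)).
apply: fnbp_window => //; first exact: ltW.
- by rewrite mulr_ge0 ?divr_ge0 ?mulr_ge0 ?(ltW p0) ?(ltW alpha0) ?(ltW t0).
- rewrite ltr_pM2r// ltr_pdivrMr ?mulr_gt0//.
  have -> : g1 * (4 * alpha) = 16 * p by field; rewrite gt_eqF.
  by rewrite ltr_pMl// ltr1n.
Qed.

Let window_ge0 t y : 0 < t -> g0 * t <= y -> 0 <= y.
Proof.
move=> t0; apply: le_trans.
by rewrite mulr_ge0 ?divr_ge0 ?mulr_ge0 ?(ltW p0) ?(ltW alpha0) ?(ltW t0).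
Qed.

(** On the typical window of G t, the bound of [fpp_upper_tail] at the time
    s t ^ beta with u = K / t does not depend on t. *)
Lemma fnbp_upper_tail t s K : 0 < t -> 0 < s -> 0 <= K ->
  (P [set w | (4 * (lambda * s) * t `^ beta < Q t w)%R] <=
    (expR (K * g1 - s * K `^ beta) +
      (2 * expR (- (lambda * s / 4 * t `^ beta)) + 2 * expR (- (p / 4 * t))))%:E)%E.
Proof.
move=> t0 s0 K0; rewrite addrA.
apply: (fnbp_typical_window (O := [set v | 4 * (lambda * s) * t `^ beta < v])) => //.
move=> y /andP[y0 y1].
have st0 : 0 < s * t `^ beta by rewrite mulr_gt0// powR_gt0.
have -> : 4 * (lambda * s) * t `^ beta = 4 * (lambda * (s * t `^ beta)).
  by rewrite !mulrA.
apply: le_trans (fpp_upper_tail lambda0 fppNb (window_ge0 t0 y0) st0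
  (divr_ge0 K0 (ltW t0))) _.
have -> : s * t `^ beta * (K / t) `^ beta = s * K `^ beta.
  by rewrite -mulrA powR_scale.
have -> : lambda * (s * t `^ beta) / 4 = lambda * s / 4 * t `^ beta by ring.
rewrite lee_fin lerD2r ler_expR lerD2r.
by rewrite mulrAC -mulrA ler_wpM2l// ler_pdivrMr.
Qed.

(** Here u = 1 / (g0 t), where g0 t is the lower end of the window of G t. *)
Lemma fnbp_lower_tail t s : 0 < t -> 0 < s ->
  (P [set w | (Q t w < lambda * s / 4 * t `^ beta)%R] <=
    (2 * (s * g0^-1 `^ beta) +
      (2 * expR (- (lambda * s / 4 * t `^ beta)) + 2 * expR (- (p / 4 * t))))%:E)%E.
Proof.
move=> t0 s0; rewrite addrA.
apply: (fnbp_typical_window (O := [set v | v < lambda * s / 4 * t `^ beta])) => //.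
move=> y /andP[y0 y1].
have st0 : 0 < s * t `^ beta by rewrite mulr_gt0// powR_gt0.
have g0_gt0 : 0 < g0 by rewrite divr_gt0// mulr_gt0.
have tg0 : 0 < g0^-1 / t by rewrite divr_gt0 ?invr_gt0.
have -> : lambda * s / 4 * t `^ beta = lambda * (s * t `^ beta) / 4 by ring.
apply: le_trans (fpp_lower_tail lambda0 fppNb (window_ge0 t0 y0) st0 tg0 _) _.
  by rewrite -invfM [leRHS]mulrC ler_pdivlMr ?(mulr_gt0 g0_gt0 t0)// mul1r.
have -> // : s * t `^ beta * (g0^-1 / t) `^ beta = s * g0^-1 `^ beta.
by rewrite -mulrA powR_scale ?invr_ge0 ?(ltW g0_gt0).
Qed.

Lemma fnbp_ge0 t : 0 < t -> P [set w | Q t w < 0] = 0%E.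
Proof.
move=> t0; set x := P _.
have mQ : measurable [set w | Q t w < 0] by exact: measurable_lt.
have xfin : x \is a fin_num by exact: fin_num_measure.
apply/eqP; rewrite eq_le measure_ge0 andbT -(fineK xfin) lee_fin.
apply/ler_addgt0Pr => e e0; rewrite add0r -lee_fin fineK//.
have z0 : 0 < 2 `^ (p * t) / e by rewrite divr_gt0 ?powR_gt0.
(* The Chernoff bound for G t at M is 2 ^ (p t) exp (- alpha M / 2) <= e. *)
pose M := 2 / alpha * (2 `^ (p * t) / e).
have M0 : 0 < M by rewrite mulr_gt0// divr_gt0.
have Nneg s : 0 <= s <= M -> (P [set w | (Nb s w < 0)%R] <= 0%:E)%E.
  by move=> /andP[s0 _]; rewrite (fpp_ge0 fppNb).
have oO : open [set v : R | v < 0] by [].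
have := fnbp_window (ltW t0) oO (lexx 0) M0 Nneg.
rewrite add0e -/x => /le_trans; apply.
have c0 : 0 < 2 :> R by [].
have mM : measurable `[M, +oo[%classic by exact: measurable_itv.
apply: le_trans (_ : _ <= P (G t @^-1` `[M, +oo[%classic))%E _.
  rewrite le_measure ?inE//.
  - exact: measurable_outside.
  - exact: measurable_funPTI.
  - move=> w /= H; rewrite in_itv/= andbT leNgt; apply: contra H => GM.
    rewrite GM andbT; have [[G0 ndG _ _ _] _] := gammaG.
    by rewrite -(G0 w); apply: ndG => //; exact: ltW.
apply: le_trans (gamma_chernoff (K := 2 `^ (p * t) / e) gammaG t0 c0 mM _) _.
  move=> y; rewrite /= in_itv/= andbT => My _.
  apply: (@le_trans _ _ (alpha * (1 - 2^-1) * M)).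
    rewrite /M le_eqVlt; apply/orP; left; apply/eqP.
    by move: (2 `^ _ / e) => z; field; rewrite gt_eqF.
  by apply: ler_wpM2l => //; rewrite mulr_ge0 ?(ltW alpha0)//; lra.
rewrite lee_fin; apply: le_trans (_ : (2 `^ (p * t) / e)^-1 * 2 `^ (p * t) <= _).
  by rewrite ler_pM2r ?powR_gt0// expRN_le_inv.
by rewrite invfM invrK mulrAC mulVf ?mul1r// gt_eqF// powR_gt0.
Qed.

End fnbp.

(** * Failure of infinite divisibility at large times *)

Theorem theorem4p3 (R : realType) (beta alpha p lambda : R)
    (hbeta : 0 < beta < 1) (halpha : 0 < alpha) (hp : 0 < p)
    (hlambda : 0 < lambda)
    (d : measure_display) (T : measurableType d) (P : probability T R)
    (Q : R -> {RV P >-> R})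
    (hQ : fractional_negative_binomial_process beta alpha p lambda Q) :
  exists t0 : R, forall t : R, t0 <= t ->
    ~ infinitely_divisible (distribution P (Q t)).
Proof.
have /andP[beta0 beta1] := hbeta.
case: hQ => Nb [G [fppNb gammaG indNbG QE]].
have p40 : 0 < p / 4 by rewrite divr_gt0.
pose g1 := 4 * p / alpha; pose g0 := p / (4 * alpha).
have g10 : 0 < g1 by rewrite divr_gt0// mulr_gt0.
have g00 : 0 < g0 by rewrite divr_gt0// mulr_gt0.
have gb0 : 0 < g0^-1 `^ beta by rewrite powR_gt0// invr_gt0.
(* At s = b the leading term 2 s g0 ^ (- beta) of the lower tail is 1 / 2; the
   choice a = b / 32 then yields A = B / 2. *)
pose b := (4 * g0^-1 `^ beta)^-1.
have b0 : 0 < b by rewrite invr_gt0 mulr_gt0.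
pose a := b / 32.
have a0 : 0 < a by rewrite divr_gt0.
pose A := 4 * (lambda * a); pose B := lambda * b / 4.
have A0 : 0 < A by rewrite mulr_gt0// mulr_gt0.
have AB : A < B.
  rewrite /A /B /a; have : 0 < lambda * b by rewrite mulr_gt0.
  rewrite (_ : 4 * (lambda * (b / 32)) = lambda * b / 8); last by field.
  by move: (lambda * b) => z z0; lra.
(* The exponent K g1 - a K ^ beta is negative for small K because beta < 1; at
   this K the first term is half the second. *)
pose K := (a / (2 * g1)) `^ (1 - beta)^-1.
have ag0 : 0 < a / (2 * g1) by rewrite divr_gt0// mulr_gt0.
have K0 : 0 < K by exact: powR_gt0.
pose theta := expR (K * g1 - a * K `^ beta).
have th1 : theta < 1.
  rewrite expR_lt1.
  have KE : K = K `^ beta * (a / (2 * g1)).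
    have -> : a / (2 * g1) = K `^ (1 - beta).
      by rewrite /K -powRrM mulVf ?powRr1 ?ltW// gt_eqF// subr_gt0.
    rewrite -powRD; last by apply/implyP => _; rewrite gt_eqF.
    by rewrite addrC subrK powRr1 ?ltW.
  have -> : K * g1 = K `^ beta * a / 2.
    by rewrite {1}KE; field; rewrite gt_eqF.
  have : 0 < K `^ beta * a by rewrite mulr_gt0// powR_gt0.
  by rewrite [a * _]mulrC; move: (_ * a) => z z0; lra.
(* For large t, P (Q t > A tau) <= (1 + theta) / 2 and P (Q t < B tau) <= 3 / 4. *)
pose c := Num.min (1 / 4) ((1 - theta) / 2).
have c0 : 0 < c by rewrite lt_min !divr_gt0// subr_gt0.
pose v0 := c * ((expR (- A) - expR (- B)) / 2) ^+ 2.
have v00 : 0 < v0.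
  by rewrite mulr_gt0// exprn_gt0// divr_gt0// subr_gt0 ltr_expR ltrN2.
have c14 : c <= 1 / 4 by rewrite ge_min lexx.
have cth : c <= (1 - theta) / 2 by rewrite ge_min lexx orbT.
pose L := A - ln c.
have L0 : 0 < L.
  rewrite /L subr_gt0 (le_lt_trans _ A0)// ln_le0// (le_trans c14)//.
  by lra.
(* With h = 1 / tau and x = xi tau the two error terms of the criterion will be
   v0 / 4 each: this fixes xi, and then delta once n is known. *)
pose xi := v0 / (4 * L).
have xi0 : 0 < xi by rewrite divr_gt0// mulr_gt0.
pose kappa := xi / (4 * lambda).
have kappa0 : 0 < kappa by rewrite divr_gt0// mulr_gt0.
have [n n0 Hn] := expR_powR_small g1 beta0 kappa0 (divr_gt0 v00 (ltr0n R 8)).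
have n0R : 0 < n%:R :> R by rewrite ltr0n.
pose delta := v0 / 4 / n%:R.
have delta0 : 0 < delta by rewrite !divr_gt0.
(* The main term of the tail at n x is at most (delta / 2) ^ n, which leaves this
   gap for the errors that vanish as t grows. *)
have gap0 : 0 < delta ^+ n - (delta / 2) ^+ n.
  by rewrite subr_gt0 (ltr_pXn2r n0) ?nnegrE; move: (delta) delta0 => z z0; lra.
have xis0 : 0 < n%:R * xi / (4 * lambda).
  by apply: divr_gt0 (mulr_gt0 n0R xi0) _; rewrite mulr_gt0.
(* The level n xi tau is 4 lambda sn tau. *)
set sn := n%:R * xi / (4 * lambda) in xis0.
have th0 : 0 < (1 - theta) / 2 by rewrite divr_gt0// subr_gt0.
have la s : 0 < s -> 0 < lambda * s / 4 by move=> s0; rewrite divr_gt0// mulr_gt0.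
have [ta ta0 Ha] := eventually_small beta0 (la _ a0) p40 th0.
have [tb tb0 Hb] := eventually_small beta0 (la _ b0) p40 (divr_gt0 (@ltr01 R) (ltr0n R 4)).
have [tn tn0 Hs] := eventually_small beta0 (la _ xis0) p40 gap0.
exists (Num.max ta (Num.max tb tn)) => t.
rewrite !ge_max => /and3P[/Ha{}Ha /Hb{}Hb tnt]; have {}Hs := Hs _ tnt.
have t0 : 0 < t by exact: lt_le_trans tnt.
have tau0 : 0 < t `^ beta by exact: powR_gt0.
set tau := t `^ beta in Ha Hb Hs tau0.
have compl (C : set T) (x : R) : measurable C -> (P C <= x%:E)%E ->
    ((1 - x)%:E <= P (~` C))%E.
  by move=> mC Cx; rewrite probability_setC// EFinB; exact: leeB.
have PA : (c%:E <= P [set w | (Q t w <= A * tau)%R])%E.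
  rewrite (_ : [set w | Q t w <= A * tau] = ~` [set w | A * tau < Q t w]); last first.
    by apply/seteqP; split => w /=; rewrite leNgt => /negP.
  apply: le_trans (compl _ (theta + (1 - theta) / 2) _ _).
  - by rewrite lee_fin; lra.
  - exact: measurable_gt.
  apply: le_trans (fnbp_upper_tail halpha hp hlambda fppNb gammaG indNbG QE
    t0 a0 (ltW K0)) _.
  by rewrite lee_fin -/g1 -/theta lerD2l.
have PB : (c%:E <= P [set w | (B * tau <= Q t w)%R])%E.
  rewrite (_ : [set w | B * tau <= Q t w] = ~` [set w | Q t w < B * tau]); last first.
    by apply/seteqP; split => w /=; rewrite leNgt => /negP.
  apply: le_trans (compl _ (1 / 2 + 1 / 4) _ _).
  - by rewrite lee_fin; lra.
  - exact: measurable_lt.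
  apply: le_trans (fnbp_lower_tail halpha hp hlambda fppNb gammaG indNbG QE
    t0 b0) _.
  rewrite lee_fin lerD// -/g0 /b.
  rewrite le_eqVlt; apply/orP; left; apply/eqP.
  by field; rewrite gt_eqF.
have Ptail : (P [set w | (n%:R * (xi * tau) < Q t w)%R] <= (delta ^+ n)%:E)%E.
  have -> : n%:R * (xi * tau) = 4 * (lambda * sn) * tau.
    by rewrite /sn; field; rewrite gt_eqF.
  apply: le_trans (fnbp_upper_tail halpha hp hlambda fppNb gammaG indNbG QE
    t0 xis0 (ler0n R n)) _.
  rewrite lee_fin -[leRHS](subrK ((delta / 2) ^+ n)) addrC lerD// -/g1.
  have -> : n%:R * g1 - sn * n%:R `^ beta = n%:R * (g1 - kappa * n%:R `^ beta).
    by rewrite /sn /kappa; field; rewrite gt_eqF.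
  have d20 : 0 <= delta / 2 by move: (delta) delta0 => z z0; lra.
  rewrite expRM_natl (ler_pXn2r n0) ?nnegrE ?expR_ge0//.
  apply: le_trans Hn _; rewrite /delta le_eqVlt; apply/orP; left; apply/eqP.
  by field; rewrite gt_eqF.
apply: (not_infinitely_divisible (h := tau^-1) (x := xi * tau) (A := A * tau)
  (B := B * tau) (c := c) (delta := delta) n0).
- by rewrite invr_gt0.
- by rewrite mulr_ge0 ?ltW.
- by rewrite mulr_ge0 ?ltW.
- by rewrite ltr_pM2r.
- exact: c0.
- exact: ltW.
- exact: (fnbp_ge0 halpha fppNb gammaG indNbG QE t0).
- exact: PA.
- exact: PB.
- exact: Ptail.
have cancel z : tau^-1 * (z * tau) = z by rewrite mulrCA mulVf ?mulr1// gt_eqF.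
rewrite !cancel -/v0 -/L.
have -> : xi * L = v0 / 4 by rewrite /xi; field; rewrite gt_eqF.
have -> : n%:R * delta = v0 / 4 by rewrite /delta mulrC divfK ?gt_eqF.
by lra.
Qed.
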